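(* There exists a bounded sequence $\beta=(\beta_n)_{n\ge0}$ of positive numbers which has a polynomial minoration and is not essentially decreasing, such that every symbol $\phi$ with $\phi(0)=0$ induces a bounded composition operator $C_\phi$ on $H^2(\beta)$.
   Context: $H^2(\beta)$ is the Hilbert space of analytic functions $f(z)=\sum_{n\ge0}a_nz^n$ on the unit disk $\mathbb D$ with $\|f\|^2=\sum_{n\ge0}|a_n|^2\beta_n<\infty$. A symbol is a non-constant analytic map $\phi:\mathbb D\to\mathbb D$ and $C_\phi f=f\circ\phi$. $\beta$ is essentially decreasing if there is $C\ge1$ with $\beta_m\le C\beta_n$ for all $m\ge n\ge0$. $\beta$ has a polynomial minoration if there are constants $\delta,\alpha>0$ with $\beta_n\ge\delta n^{-\alpha}$ for all $n\ge1$. *)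

(* Defs.v *)
From Stdlib Require Import Reals.
From Coquelicot Require Import Coquelicot.
Open Scope R_scope.

Definition CC := Complex.C.
Definition cpow (z : CC) (n : nat) : CC := @pow_n C_Ring z n.

Definition in_disk (z : CC) : Prop := Cmod z < 1.

Definition analytic_on_disk (f : CC -> CC) : Prop :=
  forall z0, in_disk z0 ->
    exists r, 0 < r /\ exists c : nat -> CC,
      forall z, Cmod (Cminus z z0) < r ->
        @is_series C_AbsRing C_NormedModule
          (fun n => Cmult (c n) (cpow (Cminus z z0) n)) (f z).

Definition symbol (phi : CC -> CC) : Prop :=
  analytic_on_disk phi /\
  (forall z, in_disk z -> in_disk (phi z)) /\
  (exists z1 z2, in_disk z1 /\ in_disk z2 /\ phi z1 <> phi z2).

Definition wterm (beta : nat -> R) (a : nat -> CC) (n : nat) : R :=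
  (Cmod (a n)) ^ 2 * beta n.

(* a is the coefficient sequence of an element f(z) = sum a_n z^n of H^2(beta):
   the series defines an analytic function on D and ||f||^2 < oo *)
Definition in_H2 (beta : nat -> R) (a : nat -> CC) : Prop :=
  ex_series (wterm beta a) /\
  (forall z, in_disk z ->
     @ex_series C_AbsRing C_NormedModule (fun n => Cmult (a n) (cpow z n))).

Definition H2norm2 (beta : nat -> R) (a : nat -> CC) : R := Series (wterm beta a).

Definition has_value (a : nat -> CC) (z w : CC) : Prop :=
  @is_series C_AbsRing C_NormedModule (fun n => Cmult (a n) (cpow z n)) w.

Definition bounded_composition (beta : nat -> R) (phi : CC -> CC) : Prop :=
  exists M : R, forall a, in_H2 beta a ->
    exists b, in_H2 beta b /\
      (forall z, in_disk z -> exists w, has_value b z w /\ has_value a (phi z) w) /\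
      H2norm2 beta b <= M * H2norm2 beta a.

Definition essentially_decreasing (beta : nat -> R) : Prop :=
  exists C0, 1 <= C0 /\ forall m n : nat, (n <= m)%nat -> beta m <= C0 * beta n.

Definition polynomial_minoration (beta : nat -> R) : Prop :=
  exists delta alpha, 0 < delta /\ 0 < alpha /\
    forall n : nat, (1 <= n)%nat -> delta * Rpower (INR n) (- alpha) <= beta n.

(* Main.v *)
Require Import Defs.
From Stdlib Require Import Arith Reals Lra Lia.
From Coquelicot Require Import Coquelicot.
Open Scope R_scope.

(** The weight is [1 / k!] on the block [k! <= n < (k+1)!], except that it keeps the value
    [1 / (k-1)!] of the previous block at the single index [k! + 1]: a dip at [k!] is followed by
    a spike larger by the factor [k].

    If [phi z = sum c_n z^n] with [c_0 = 0], the matrix of the composition operator is lower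
    triangular, and Littlewood's subordination principle gives
    [sum_(n < N) |b_n|^2 <= sum_(n < N) |a_n|^2] for the coefficients [b] of [f o phi].
    Abel summation turns this into a contraction for the decreasing minorant of the weight, so
    only the spikes matter.  At a spike [n], the coefficients of [f] other than [a_(n-1)] are
    harmless because the weight has dropped by the factor [k] between [n - 2] and [n - 1], and
    [a_(n-1)] enters through the coefficient of [z^n] in [phi^(n-1)], whose modulus is
    [(n-1) |c_1|^(n-2) |c_2|].  This beats [k] if [|c_1| < 1], and [c_2 = 0] if [|c_1| = 1].

    The global power series of [phi] comes from Cauchy's formula, proved by differentiating
    [s |-> int phi (w + s (zeta - w)) zeta / (zeta - w) dt] under the integral sign. *)

(** * Finite sums and complex series *)

(** A function in [H^2(beta)] need not have square-summable coefficients, as the weight tends to 0.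
    Hence every estimate is made on finite sections of the matrix, which triangularity makes
    self-contained, and the coefficients so obtained are only afterwards shown to sum to [f o phi]
    pointwise. The factorials serve two ends. On the block starting at [k!] the value [1 / k!] is at
    least [1 / n], so the minoration has exponent 1. And consecutive values have ratio [k >= 2], so
    a spike is at most twice as high as the drop of the decreasing minorant just before it; the sum
    over all spikes of height times a partial sum of [|a_j|^2] is then dominated by an Abel sum and
    does not accumulate. The unbounded ratio [k] between spike and dip is felt by a single matrix
    entry. Since [k] is at most the index of the spike, it is enough that the squared entry is of
    order one over that index. What ties the size of [c_2] to that of [c_1] is
    [|c_1|^2 + |c_2|^2 <= 1], a consequence of Parseval. Analyticity is given only by local
    expansions, so a single series valid on the whole disk has to be built beforehand. *)

Fixpoint csum (f : nat -> C) (n : nat) : C :=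
  match n with O => RtoC 0 | S k => (csum f k + f k)%C end.

Fixpoint rsum (f : nat -> R) (n : nat) : R :=
  match n with O => 0 | S k => rsum f k + f k end.

Lemma csum_ext f g n : (forall k, (k < n)%nat -> f k = g k) -> csum f n = csum g n.
Proof.
  induction n as [|n IH]; intros H; simpl; [reflexivity|].
  rewrite IH, H by (auto with arith); reflexivity.
Qed.

Lemma csum_plus f g n : csum (fun k => f k + g k)%C n = (csum f n + csum g n)%C.
Proof. induction n as [|n IH]; simpl; [|rewrite IH]; ring. Qed.

Lemma csum_scal a f n : csum (fun k => a * f k)%C n = (a * csum f n)%C.
Proof. induction n as [|n IH]; simpl; [|rewrite IH]; ring. Qed.

Lemma csum_zero f n : (forall k, (k < n)%nat -> f k = RtoC 0) -> csum f n = RtoC 0.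
Proof.
  induction n as [|n IH]; intros H; simpl; [reflexivity|].
  rewrite IH, H by (auto with arith); ring.
Qed.

Lemma csum_shift f n : csum f (S n) = (f O + csum (fun k => f (S k)) n)%C.
Proof.
  induction n as [|n IH]; [simpl; ring|].
  change (csum f (S (S n))) with (csum f (S n) + f (S n))%C.
  rewrite IH; simpl; ring.
Qed.

Lemma csum_add f n m :
  csum f (n + m) = (csum f n + csum (fun k => f (n + k)%nat) m)%C.
Proof.
  induction m as [|m IH]; [rewrite Nat.add_0_r; simpl; ring|].
  rewrite Nat.add_succ_r; simpl; rewrite IH; ring.
Qed.

Lemma csum_swap (f : nat -> nat -> C) n m :
  csum (fun i => csum (f i) m) n = csum (fun j => csum (fun i => f i j) n) m.
Proof.
  induction n as [|n IH]; simpl.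
  - symmetry; apply csum_zero; reflexivity.
  - rewrite IH, <- csum_plus; reflexivity.
Qed.

Lemma rsum_le f g n : (forall k, (k < n)%nat -> f k <= g k) -> rsum f n <= rsum g n.
Proof.
  induction n as [|n IH]; intros H; simpl; [lra|].
  apply Rplus_le_compat; auto with arith.
Qed.

Lemma rsum_ext f g n : (forall k, (k < n)%nat -> f k = g k) -> rsum f n = rsum g n.
Proof.
  induction n as [|n IH]; intros H; simpl; [reflexivity|].
  rewrite IH, H by (auto with arith); reflexivity.
Qed.

Lemma rsum_plus f g n : rsum (fun k => f k + g k) n = rsum f n + rsum g n.
Proof. induction n as [|n IH]; simpl; [|rewrite IH]; ring. Qed.

Lemma rsum_scal a f n : rsum (fun k => a * f k) n = a * rsum f n.
Proof. induction n as [|n IH]; simpl; [|rewrite IH]; ring. Qed.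

Lemma rsum_nonneg f n : (forall k, 0 <= f k) -> 0 <= rsum f n.
Proof.
  intros H; induction n as [|n IH]; simpl; [lra|].
  apply Rplus_le_le_0_compat; auto.
Qed.

Lemma rsum_shift f n : rsum f (S n) = f O + rsum (fun k => f (S k)) n.
Proof.
  induction n as [|n IH]; [simpl; ring|].
  change (rsum f (S (S n))) with (rsum f (S n) + f (S n)).
  rewrite IH; simpl; ring.
Qed.

Lemma rsum_const a n : rsum (fun _ => a) n = INR n * a.
Proof. induction n as [|n IH]; [simpl; ring|]. rewrite S_INR; simpl rsum; rewrite IH; ring. Qed.

Lemma Cmod_csum_le f n : Cmod (csum f n) <= rsum (fun k => Cmod (f k)) n.
Proof.
  induction n as [|n IH]; simpl; [rewrite Cmod_0; lra|].
  eapply Rle_trans; [apply Cmod_triangle|]; lra.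
Qed.

Lemma rsum_geom q n : 0 <= q < 1 -> rsum (fun k => q ^ k) n <= / (1 - q).
Proof.
  intros Hq.
  assert (E : (1 - q) * rsum (fun k => q ^ k) n = 1 - q ^ n).
  { induction n as [|n IH]; simpl; [ring|]. rewrite Rmult_plus_distr_l, IH; ring. }
  apply Rmult_le_reg_l with (1 - q); [lra|].
  rewrite E, Rinv_r by lra.
  assert (0 <= q ^ n) by (apply pow_le; lra); lra.
Qed.

Lemma Cmod_minus_sym (x y : C) : Cmod (x - y)%C = Cmod (y - x)%C.
Proof. rewrite <- Cmod_opp; f_equal; ring. Qed.

Lemma Cmod_minus_triangle (x y z : C) :
  Cmod (x - z)%C <= Cmod (x - y)%C + Cmod (y - z)%C.
Proof. replace (x - z)%C with ((x - y) + (y - z))%C by ring; apply Cmod_triangle. Qed.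

Lemma C_eq_eps (x y : C) : (forall eps, 0 < eps -> Cmod (x - y)%C <= eps) -> x = y.
Proof.
  intros H.
  assert (Z : (x - y)%C = RtoC 0).
  { apply Cmod_eq_0, Rle_antisym; [|apply Cmod_ge_0].
    apply Rnot_lt_le; intros P.
    specialize (H (Cmod (x - y)%C / 2)); lra. }
  replace x with ((x - y) + y)%C by ring; rewrite Z; ring.
Qed.

Lemma cpow_Cpow z n : cpow z n = Cpow z n.
Proof.
  unfold cpow; induction n as [|n IH]; [reflexivity|].
  simpl. rewrite IH; reflexivity.
Qed.

Definition cv_sum (f : nat -> C) (l : C) : Prop :=
  forall eps, 0 < eps -> exists N, forall n, (N <= n)%nat -> Cmod (csum f n - l)%C < eps.

Lemma sum_n_csum (f : nat -> C) n : @sum_n C_AbelianMonoid f n = csum f (S n).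
Proof.
  induction n as [|n IH].
  - rewrite sum_O; simpl; ring.
  - rewrite sum_Sn, IH; reflexivity.
Qed.

(** The balls of [C_UniformSpace] are squares, not discs, whence the factor [sqrt 2] in one
    direction. *)
Lemma is_series_cv_sum (f : nat -> C) (l : C) :
  @is_series C_AbsRing C_NormedModule f l <-> cv_sum f l.
Proof.
  split.
  - intros H eps He.
    assert (S2 : 0 < sqrt 2) by (apply sqrt_lt_R0; lra).
    assert (He' : 0 < eps / sqrt 2) by (apply Rdiv_lt_0_compat; lra).
    assert (L : locally l (@ball C_UniformSpace l (mkposreal _ He'))) by apply locally_ball.
    destruct (H _ L) as [N HN].
    exists (S N); intros n Hn; destruct n as [|n]; [lia|].
    rewrite <- sum_n_csum.
    assert (B := HN n ltac:(lia)).
    apply (C_NormedModule_mixin_compat2 l) in B.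
    replace eps with (sqrt 2 * (eps / sqrt 2)) by (field; lra).
    exact B.
  - intros H; unfold is_series.
    apply (filterlim_locally (F := eventually)); intros eps.
    destruct (H eps (cond_pos eps)) as [N HN].
    exists N; intros n Hn.
    apply C_NormedModule_mixin_compat1.
    change (minus (sum_n f n) l) with (@sum_n C_AbelianMonoid f n - l)%C.
    rewrite sum_n_csum; apply HN; lia.
Qed.

Lemma cv_sum_unique f l1 l2 : cv_sum f l1 -> cv_sum f l2 -> l1 = l2.
Proof.
  intros H1 H2; apply C_eq_eps; intros eps He.
  destruct (H1 (eps / 2)) as [N1 P1]; [lra|].
  destruct (H2 (eps / 2)) as [N2 P2]; [lra|].
  specialize (P1 (N1 + N2)%nat ltac:(lia)); specialize (P2 (N1 + N2)%nat ltac:(lia)).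
  rewrite Cmod_minus_sym in P1.
  eapply Rle_trans; [apply (Cmod_minus_triangle _ (csum f (N1 + N2)))|]; lra.
Qed.

Lemma cv_sum_ext f g l : (forall n, f n = g n) -> cv_sum f l -> cv_sum g l.
Proof.
  intros E H eps He; destruct (H eps He) as [N HN]; exists N; intros n Hn.
  rewrite <- (csum_ext f g) by auto; auto.
Qed.

Lemma cv_sum_bounded f l : cv_sum f l -> exists B, 0 < B /\ forall n, Cmod (f n) <= B.
Proof.
  intros H; destruct (H 1) as [N HN]; [lra|].
  assert (P : 0 <= rsum (fun k => Cmod (f k)) N)
    by (apply rsum_nonneg; intros; apply Cmod_ge_0).
  exists (2 + rsum (fun k => Cmod (f k)) N); split; [lra|]; intros n.
  destruct (le_lt_dec N n) as [L|L].
  - assert (A1 := HN n L); assert (A2 := HN (S n) ltac:(lia)).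
    replace (f n) with ((csum f (S n) - l) - (csum f n - l))%C by (simpl; ring).
    rewrite Cmod_minus_sym in A1.
    eapply Rle_trans; [apply (Cmod_minus_triangle _ 0)|].
    replace (csum f (S n) - l - 0)%C with (csum f (S n) - l)%C by ring.
    replace (0 - (csum f n - l))%C with (l - csum f n)%C by ring. lra.
  - clear - L. assert (Q : Cmod (f n) <= rsum (fun k => Cmod (f k)) N); [|lra].
    induction N as [|N IH]; [lia|].
    assert (G := Cmod_ge_0 (f N)).
    assert (0 <= rsum (fun k => Cmod (f k)) N)
      by (apply rsum_nonneg; intros; apply Cmod_ge_0).
    simpl; destruct (Nat.eq_dec n N) as [->|D]; [lra|].
    specialize (IH ltac:(lia)); lra.
Qed.

Lemma cv_sum_limit_bound f l a B N :
  cv_sum f l -> (forall n, (N <= n)%nat -> Cmod (csum f n - a)%C <= B) -> Cmod (l - a)%C <= B.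
Proof.
  intros H Q; apply Rnot_lt_le; intros P.
  destruct (H (Cmod (l - a)%C - B)) as [M HM]; [lra|].
  specialize (HM (M + N)%nat ltac:(lia)); specialize (Q (M + N)%nat ltac:(lia)).
  assert (T := Cmod_minus_triangle l (csum f (M + N)) a).
  rewrite (Cmod_minus_sym l (csum f (M + N))) in T; lra.
Qed.

Lemma csum_tail_bound f K q N m :
  0 <= q < 1 -> 0 <= K -> (forall n, (N <= n)%nat -> Cmod (f n) <= K * q ^ n) ->
  Cmod (csum f (N + m) - csum f N)%C <= K * q ^ N / (1 - q).
Proof.
  intros Hq HK H.
  rewrite csum_add.
  replace (csum f N + csum (fun k => f (N + k)%nat) m - csum f N)%C
    with (csum (fun k => f (N + k)%nat) m) by ring.
  eapply Rle_trans; [apply Cmod_csum_le|].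
  eapply Rle_trans.
  { apply (rsum_le _ (fun k => (K * q ^ N) * q ^ k)); intros k _.
    rewrite Rmult_assoc, <- pow_add; apply H; lia. }
  rewrite rsum_scal.
  apply Rmult_le_compat_l; [apply Rmult_le_pos; [lra|apply pow_le; lra]|].
  apply rsum_geom; lra.
Qed.

Lemma cv_sum_tail_bound f l K q N :
  cv_sum f l -> 0 <= q < 1 -> 0 <= K -> (forall n, (N <= n)%nat -> Cmod (f n) <= K * q ^ n) ->
  Cmod (l - csum f N)%C <= K * q ^ N / (1 - q).
Proof.
  intros H Hq HK B; apply (cv_sum_limit_bound f l _ _ N H).
  intros n Hn; replace n with (N + (n - N))%nat by lia.
  apply csum_tail_bound; auto.
Qed.

Lemma ex_cv_sum_geom f K q :
  0 <= q < 1 -> (forall n, Cmod (f n) <= K * q ^ n) -> exists l, cv_sum f l.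
Proof.
  intros Hq H.
  destruct (@ex_series_le C_AbsRing C_CompleteNormedModule f (fun n => K * q ^ n)) as [l Hl].
  - exact H.
  - apply (ex_series_scal_l K (pow q)), ex_series_geom; rewrite Rabs_pos_eq; lra.
  - exists l; apply is_series_cv_sum, Hl.
Qed.

Lemma pow_small q B eps : 0 <= q < 1 -> 0 < eps ->
  exists N, forall n, (N <= n)%nat -> B * q ^ n < eps.
Proof.
  intros Hq He.
  destruct (Rle_lt_dec B 0) as [HB|HB].
  { exists O; intros n _. assert (0 <= q ^ n) by (apply pow_le; lra). nra. }
  destruct (pow_lt_1_zero q) with (y := eps / B) as [N HN].
  - rewrite Rabs_pos_eq; lra.
  - apply Rdiv_lt_0_compat; lra.
  - exists N; intros n Hn. specialize (HN n Hn).
    rewrite Rabs_pos_eq in HN by (apply pow_le; lra).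
    apply Rmult_lt_compat_l with (r := B) in HN; [|lra].
    replace (B * (eps / B)) with eps in HN by (field; lra). exact HN.
Qed.

Lemma cv_sum_of_error f l (e : nat -> R) :
  (forall n, Cmod (csum f n - l)%C <= e n) ->
  (forall eps, 0 < eps -> exists N, forall n, (N <= n)%nat -> e n < eps) -> cv_sum f l.
Proof.
  intros H E eps He; destruct (E eps He) as [N HN]; exists N; intros n Hn.
  eapply Rle_lt_trans; [apply H|apply HN, Hn].
Qed.

Lemma nat_mul_pow_bounded q : 0 <= q < 1 -> exists B, 0 <= B /\ forall n, INR n * q ^ n <= B.
Proof.
  intros Hq; destruct (Req_dec q 0) as [->|Z].
  { exists 0; split; [lra|]; intros [|n]; [simpl; lra|]. rewrite pow_ne_zero by lia; lra. }
  assert (X : 0 < / q - 1).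
  { assert (1 < / q) by (rewrite <- Rinv_1; apply Rinv_lt_contravar; lra). lra. }
  exists (/ (/ q - 1)); split; [left; apply Rinv_0_lt_compat, X|]; intros n.
  (* Bernoulli's inequality for the powers of [/ q]. *)
  assert (P := poly n (/ q - 1) X).
  replace (1 + (/ q - 1)) with (/ q) in P by ring.
  rewrite pow_inv in P.
  assert (Q : 0 < q ^ n) by (apply pow_lt; lra).
  apply Rmult_le_reg_r with (/ q - 1); [exact X|].
  rewrite Rinv_l by lra.
  replace (INR n * q ^ n * (/ q - 1)) with ((1 + INR n * (/ q - 1)) * q ^ n - q ^ n) by ring.
  apply Rmult_le_compat_r with (r := q ^ n) in P; [|lra].
  rewrite Rinv_l in P by lra. lra.
Qed.

(** Writing [q] as [sqrt q * sqrt q] leaves one square root to absorb a factor [INR n] and the other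
    for the induction hypothesis, which is why [q] is quantified inside the induction. *)
Lemma natpow_mul_pow_bounded p : forall q, 0 <= q < 1 ->
  exists B, 0 <= B /\ forall n, INR n ^ p * q ^ n <= B.
Proof.
  induction p as [|p IH]; intros q Hq.
  - exists 1; split; [lra|]; intros n; rewrite pow_O, Rmult_1_l, <- (pow1 n).
    apply pow_incr; lra.
  - assert (S : 0 <= sqrt q < 1).
    { split; [apply sqrt_pos|]. rewrite <- sqrt_1; apply sqrt_lt_1; lra. }
    destruct (IH _ S) as [B1 [P1 H1]]; destruct (nat_mul_pow_bounded _ S) as [B2 [P2 H2]].
    exists (B1 * B2); split; [apply Rmult_le_pos; auto|]; intros n.
    replace (INR n ^ Datatypes.S p * q ^ n)
      with ((INR n ^ p * sqrt q ^ n) * (INR n * sqrt q ^ n)).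
    + assert (0 <= sqrt q ^ n) by (apply pow_le; lra).
      assert (0 <= INR n) by apply pos_INR.
      apply Rmult_le_compat; auto; apply Rmult_le_pos; auto; apply pow_le; auto.
    + rewrite <- (sqrt_sqrt q) at 3 by lra. rewrite Rpow_mult_distr; simpl; ring.
Qed.

Lemma nat_geom_small q B : 0 <= q < 1 -> forall eps, 0 < eps ->
  exists N, forall n, (N <= n)%nat -> B * INR n * q ^ n < eps.
Proof.
  intros Hq eps He.
  assert (S : 0 <= sqrt q < 1).
  { split; [apply sqrt_pos|]. rewrite <- sqrt_1; apply sqrt_lt_1; lra. }
  destruct (nat_mul_pow_bounded _ S) as [B2 [P2 H2]].
  destruct (pow_small (sqrt q) (Rabs B * B2) eps S He) as [N HN].
  exists N; intros n Hn; eapply Rle_lt_trans; [|apply (HN n Hn)].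
  rewrite <- (sqrt_sqrt q) at 1 by lra; rewrite Rpow_mult_distr.
  assert (0 <= sqrt q ^ n) by (apply pow_le; lra).
  assert (0 <= INR n * sqrt q ^ n) by (apply Rmult_le_pos; [apply pos_INR|auto]).
  replace (B * INR n * (sqrt q ^ n * sqrt q ^ n)) with (B * (INR n * sqrt q ^ n) * sqrt q ^ n) by ring.
  apply Rmult_le_compat_r; auto.
  apply Rle_trans with (Rabs B * (INR n * sqrt q ^ n)).
  - apply Rmult_le_compat_r; auto; apply Rle_abs.
  - apply Rmult_le_compat_l; auto; apply Rabs_pos.
Qed.

(** * Parseval's identity and multiplication by a bounded power series *)

(** Goals produced by the integration lemmas are equalities in the carrier of a normed module;
    [ring] needs to see the type [R]. *)
Ltac real_eq := match goal with |- @eq _ ?a ?b => change (@eq R a b) end.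

Lemma is_RInt_eq (f : R -> R) a b l l' : is_RInt f a b l -> l = l' -> is_RInt f a b l'.
Proof. intros H <-; exact H. Qed.

Lemma is_RInt_constR a b c : is_RInt (fun _ => c) a b ((b - a) * c).
Proof. exact (is_RInt_const (V := R_NormedModule) a b c). Qed.

Lemma is_RInt_plusR f g a b lf lg : is_RInt f a b lf -> is_RInt g a b lg ->
  is_RInt (fun t => f t + g t) a b (lf + lg).
Proof. exact (is_RInt_plus (V := R_NormedModule) f g a b lf lg). Qed.

Lemma is_RInt_scalR k f a b l : is_RInt f a b l -> is_RInt (fun t => k * f t) a b (k * l).
Proof. exact (is_RInt_scal (V := R_NormedModule) f a b k l). Qed.

Definition circ (r t : R) : C := (r * cos t, r * sin t).

Lemma circ_pow r t n : (circ r t ^ n)%C = (r ^ n * cos (INR n * t), r ^ n * sin (INR n * t)).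
Proof.
  induction n as [|n IH].
  - simpl; rewrite Rmult_0_l, cos_0, sin_0, !Rmult_1_l; reflexivity.
  - rewrite Cpow_S, IH, S_INR.
    replace ((INR n + 1) * t) with (t + INR n * t) by ring.
    rewrite cos_plus, sin_plus; unfold circ, Cmult; simpl; f_equal; ring.
Qed.

Lemma Cmod_sqr (z : C) : Cmod z ^ 2 = Re z ^ 2 + Im z ^ 2.
Proof. apply Cmod2_alt. Qed.

Lemma Cmod_circ r t : 0 <= r -> Cmod (circ r t) = r.
Proof.
  intros Hr; apply Rsqr_inj; [apply Cmod_ge_0|auto|].
  rewrite !Rsqr_pow2, Cmod_sqr; simpl.
  replace (r * cos t * (r * cos t * 1) + r * sin t * (r * sin t * 1))
    with (r * r * (Rsqr (sin t) + Rsqr (cos t))) by (unfold Rsqr; ring).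
  rewrite sin2_cos2; real_eq; ring.
Qed.

Lemma is_RInt_circ_pow r d (mu : C) : (0 < d)%nat ->
  is_RInt (fun t => Re (mu * circ r t ^ d)%C) 0 (2 * PI) 0.
Proof.
  intros Hd.
  assert (D : INR d <> 0) by (apply not_0_INR; lia).
  (* The real part of [mu z^d / (i d)] at [z = circ r t], which is periodic. *)
  pose (F := fun t => r ^ d / INR d * (Re mu * sin (INR d * t) + Im mu * cos (INR d * t))).
  assert (E : minus (F (2 * PI)) (F 0) = 0).
  { unfold F, minus, plus, opp; simpl.
    replace (INR d * (2 * PI)) with (0 + 2 * INR d * PI) by ring.
    rewrite Rmult_0_r, sin_period, cos_period; ring. }
  refine (eq_ind _ (fun l => is_RInt _ 0 (2 * PI) l) _ _ E).
  apply (is_RInt_derive (V := R_CompleteNormedModule) F).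
  - intros t _; rewrite circ_pow; unfold F.
    auto_derive; [exact I|]. unfold Re, Im; simpl; field; exact D.
  - intros t _.
    apply (continuous_ext (fun t => r ^ d * (Re mu * cos (INR d * t) - Im mu * sin (INR d * t)))).
    { intros u; rewrite circ_pow; unfold Re, Im; simpl; ring. }
    apply (ex_derive_continuous (V := R_NormedModule)); auto_derive; exact I.
Qed.

Lemma circ_pow_conj r t n d :
  (circ r t ^ n * Cconj (circ r t ^ (n + d)))%C = (RtoC ((r ^ n) ^ 2) * Cconj (circ r t ^ d))%C.
Proof.
  rewrite Cpow_add_r, Cmult_conj, Cmult_assoc; f_equal.
  rewrite <- Cmod2_conj. rewrite Cmod_sqr, circ_pow; unfold Re, Im; simpl fst; simpl snd.
  f_equal. replace ((r ^ n * cos (INR n * t)) ^ 2 + (r ^ n * sin (INR n * t)) ^ 2)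
    with (r ^ n * r ^ n * (Rsqr (sin (INR n * t)) + Rsqr (cos (INR n * t)))) by (unfold Rsqr; ring).
  rewrite sin2_cos2; real_eq; ring.
Qed.

Lemma is_RInt_circ_conj_pow r d (mu : C) : (0 < d)%nat ->
  is_RInt (fun t => Re (mu * Cconj (circ r t ^ d))%C) 0 (2 * PI) 0.
Proof.
  intros Hd; apply (is_RInt_ext (fun t => Re (Cconj mu * circ r t ^ d)%C)).
  - intros t _; rewrite !re_mult, !re_conj, !im_conj; real_eq; ring.
  - apply is_RInt_circ_pow, Hd.
Qed.

Definition pe (p : nat -> C) (z : C) (n : nat) : C := csum (fun k => p k * z ^ k)%C n.

(** Orthogonality of distinct frequencies, in the shape required by the induction in [parseval]:
    adding one monomial to a polynomial of lower degree creates only this cross term. *)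
Lemma is_RInt_cross r p N M (lam : C) : (N <= M)%nat ->
  is_RInt (fun t => Re (pe p (circ r t) N * Cconj (lam * circ r t ^ M))%C) 0 (2 * PI) 0.
Proof.
  unfold pe; induction N as [|N IH]; intros H.
  - apply (is_RInt_ext (fun _ => 0)).
    + intros t _; simpl csum; rewrite Cmult_0_l; reflexivity.
    + eapply is_RInt_eq; [apply is_RInt_constR|real_eq; ring].
  - apply (is_RInt_ext (fun t =>
       Re (csum (fun k => p k * circ r t ^ k) N * Cconj (lam * circ r t ^ M))%C +
       Re ((RtoC ((r ^ N) ^ 2) * p N * Cconj lam) * Cconj (circ r t ^ (M - N)))%C)).
    + intros t _; simpl csum; rewrite Cmult_plus_distr_r, re_plus; real_eq; f_equal; f_equal.
      assert (E := circ_pow_conj r t N (M - N)).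
      replace (N + (M - N))%nat with M in E by lia.
      rewrite Cmult_conj.
      transitivity (p N * Cconj lam * (circ r t ^ N * Cconj (circ r t ^ M)))%C; [|ring].
      rewrite E; ring.
    + eapply is_RInt_eq; [apply is_RInt_plusR; [apply IH; lia|]|apply Rplus_0_l].
      apply is_RInt_circ_conj_pow; lia.
Qed.

Lemma Cmod_plus_sqr (x y : C) :
  Cmod (x + y)%C ^ 2 = Cmod x ^ 2 + 2 * Re (x * Cconj y)%C + Cmod y ^ 2.
Proof. rewrite !Cmod_sqr, re_mult, re_conj, im_conj; unfold Re, Im; simpl; ring. Qed.

Lemma parseval r p N : 0 <= r ->
  is_RInt (fun t => Cmod (pe p (circ r t) N) ^ 2) 0 (2 * PI)
    (2 * PI * rsum (fun n => (Cmod (p n) * r ^ n) ^ 2) N).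
Proof.
  intros Hr; induction N as [|N IH].
  - apply (is_RInt_ext (fun _ => 0)).
    + intros t _; unfold pe; simpl csum; rewrite Cmod_0; real_eq; ring.
    + eapply is_RInt_eq; [apply is_RInt_constR|simpl; real_eq; ring].
  - apply (is_RInt_ext (fun t => Cmod (pe p (circ r t) N) ^ 2 +
       2 * Re (pe p (circ r t) N * Cconj (p N * circ r t ^ N))%C + (Cmod (p N) * r ^ N) ^ 2)).
    + intros t _; unfold pe; simpl csum; rewrite Cmod_plus_sqr.
      rewrite Cmod_mult, Cmod_pow, Cmod_circ by auto; reflexivity.
    + eapply is_RInt_eq.
      * apply is_RInt_plusR; [|apply is_RInt_constR].
        apply is_RInt_plusR; [exact IH|].
        apply is_RInt_scalR, is_RInt_cross; auto.
      * simpl; real_eq; ring.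
Qed.

(** * Cauchy products, and multiplication by [phi] as a contraction *)

Definition sh (i : nat) (g : nat -> C) (n : nat) : C :=
  if Nat.leb i n then g (n - i)%nat else RtoC 0.

(** The Cauchy product, written with zero-padded shifts so that its range of summation can be
    enlarged freely and double sums swapped over rectangles. *)
Definition conv (p g : nat -> C) (n : nat) : C := csum (fun i => p i * sh i g n)%C (S n).

Lemma csum_extend f n m : (n <= m)%nat -> (forall k, (n <= k)%nat -> f k = RtoC 0) ->
  csum f m = csum f n.
Proof.
  intros H Z; replace m with (n + (m - n))%nat by lia.
  rewrite csum_add, (csum_zero (fun k => f (n + k)%nat)); [ring|].
  intros k _; apply Z; lia.
Qed.

Lemma conv_extend p g n N : (n < N)%nat -> conv p g n = csum (fun i => p i * sh i g n)%C N.
Proof.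
  intros H; unfold conv; symmetry; apply csum_extend; [lia|].
  intros k Hk; unfold sh; destruct (Nat.leb_spec k n); [lia|ring].
Qed.

Lemma pe_sh i g z N : (i <= N)%nat -> pe (sh i g) z N = (z ^ i * pe g z (N - i))%C.
Proof.
  intros H; unfold pe; replace N with (i + (N - i))%nat at 1 by lia.
  rewrite csum_add, csum_zero, <- csum_scal.
  - rewrite Cplus_0_l; apply csum_ext; intros k _.
    unfold sh; destruct (Nat.leb_spec i (i + k)); [|lia].
    replace (i + k - i)%nat with k by lia; rewrite Cpow_add_r; ring.
  - intros k Hk; unfold sh; destruct (Nat.leb_spec i k); [lia|ring].
Qed.

Lemma pe_conv p g z N :
  pe (conv p g) z N = csum (fun i => p i * z ^ i * pe g z (N - i))%C N.
Proof.
  unfold pe at 1.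
  rewrite (csum_ext _ (fun n => csum (fun i => p i * (sh i g n * z ^ n))%C N)).
  - rewrite csum_swap; apply csum_ext; intros i Hi.
    rewrite csum_scal; change (csum (fun n => sh i g n * z ^ n)%C N) with (pe (sh i g) z N).
    rewrite pe_sh by lia; ring.
  - intros n Hn; rewrite (conv_extend p g n N Hn), Cmult_comm, <- csum_scal.
    apply csum_ext; intros; ring.
Qed.

Definition trunc (K : nat) (p : nat -> C) (n : nat) : C := if Nat.ltb n K then p n else RtoC 0.

Lemma trunc_lt K p n : (n < K)%nat -> trunc K p n = p n.
Proof. intros H; unfold trunc; destruct (Nat.ltb_spec n K); [reflexivity|lia]. Qed.

Lemma trunc_ge K p n : (K <= n)%nat -> trunc K p n = RtoC 0.
Proof. intros H; unfold trunc; destruct (Nat.ltb_spec n K); [lia|reflexivity]. Qed.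

Lemma pe_trunc K p z n : (K <= n)%nat -> pe (trunc K p) z n = pe p z K.
Proof.
  intros H; unfold pe; rewrite (csum_extend _ K n H).
  - apply csum_ext; intros k Hk; rewrite trunc_lt by auto; reflexivity.
  - intros k Hk; rewrite trunc_ge by auto; ring.
Qed.

(** Between polynomials the product formula is exact, so Parseval can be applied to it without any
    remainder. *)
Lemma pe_conv_trunc p g z K L :
  pe (conv (trunc K p) (trunc L g)) z (K + L) = (pe p z K * pe g z L)%C.
Proof.
  rewrite pe_conv, (csum_extend _ K); [|lia|].
  - rewrite Cmult_comm; unfold pe at 3. rewrite <- csum_scal; apply csum_ext; intros i Hi.
    rewrite trunc_lt, pe_trunc by lia; ring.
  - intros i Hi; rewrite trunc_ge by auto; ring.
Qed.

Lemma conv_local p p' g g' n : (forall k, (k <= n)%nat -> p k = p' k) ->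
  (forall k, (k <= n)%nat -> g k = g' k) -> conv p g n = conv p' g' n.
Proof.
  intros Hp Hg; apply csum_ext; intros i Hi; rewrite Hp by lia.
  unfold sh; destruct (Nat.leb_spec i n); [rewrite Hg by lia|]; reflexivity.
Qed.

Definition ps_on (R0 : R) (c : nat -> C) (phi : C -> C) : Prop :=
  forall z, Cmod z < R0 -> cv_sum (fun n => c n * z ^ n)%C (phi z).

Lemma ps_coeff_bound R0 c phi rho : ps_on R0 c phi -> 0 < rho < R0 ->
  exists B, 0 < B /\ forall n, Cmod (c n) <= B * (/ rho) ^ n.
Proof.
  intros H Hr; destruct (cv_sum_bounded _ _ (H (RtoC rho) ltac:(rewrite Cmod_R, Rabs_pos_eq; lra)))
    as [B [HB P]].
  exists B; split; [exact HB|]; intros n; specialize (P n).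
  rewrite Cmod_mult, Cmod_pow, Cmod_R, Rabs_pos_eq in P by lra.
  assert (Q : 0 < rho ^ n) by (apply pow_lt; lra).
  rewrite pow_inv; apply Rmult_le_reg_r with (rho ^ n); [exact Q|].
  rewrite Rmult_assoc, Rinv_l by lra; lra.
Qed.

Lemma ps_uniform c phi r eps : ps_on 1 c phi -> 0 < r < 1 -> 0 < eps ->
  exists N, forall K z, (N <= K)%nat -> Cmod z <= r -> Cmod (phi z - pe c z K)%C <= eps.
Proof.
  intros H Hr He.
  (* A radius strictly between [r] and 1 makes the tail on the disk of radius [r] geometric, with
     ratio [q] below. *)
  destruct (ps_coeff_bound 1 c phi ((1 + r) / 2) H) as [B [HB P]]; [lra|].
  pose (q := r / ((1 + r) / 2)).
  assert (Hq : 0 <= q < 1).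
  { unfold q; split; [apply Rdiv_le_0_compat; lra|].
    apply Rmult_lt_reg_r with ((1 + r) / 2); [lra|].
    unfold Rdiv at 1; rewrite Rmult_assoc, Rinv_l by lra; lra. }
  destruct (pow_small q (B / (1 - q)) eps Hq He) as [N HN].
  exists N; intros K z HK Hz.
  eapply Rle_trans; [apply (cv_sum_tail_bound _ _ B q K (H z ltac:(lra)))|].
  - exact Hq.
  - lra.
  - intros n _; rewrite Cmod_mult, Cmod_pow.
    apply Rle_trans with (B * (/ ((1 + r) / 2)) ^ n * r ^ n).
    + apply Rmult_le_compat; [apply Cmod_ge_0|apply pow_le, Cmod_ge_0|apply P|].
      apply pow_incr; split; [apply Cmod_ge_0|auto].
    + unfold q, Rdiv at 2; rewrite Rpow_mult_distr; lra.
  - specialize (HN K HK); left. unfold Rdiv in *. lra.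
Qed.

Lemma rsum_mono f n m : (n <= m)%nat -> (forall k, 0 <= f k) -> rsum f n <= rsum f m.
Proof.
  intros H P; induction H as [|m H IH]; [lra|]; simpl; specialize (P m); lra.
Qed.

(** On the circle of radius [r] a long Taylor polynomial of [phi] has modulus at most [1 + eps].
    Multiplying the truncated [g] by it costs at most that factor in the mean square, and Parseval
    turns this into coefficients; those of index [L] and beyond in the product are simply dropped
    from the left side. *)
Lemma conv_contractive_aux c phi g L r eps :
  ps_on 1 c phi -> (forall z, Cmod z < 1 -> Cmod (phi z) <= 1) -> 0 < r < 1 -> 0 < eps ->
  rsum (fun n => (Cmod (conv c g n) * r ^ n) ^ 2) L
    <= (1 + eps) ^ 2 * rsum (fun n => (Cmod (g n) * r ^ n) ^ 2) L.
Proof.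
  intros H B Hr He.
  destruct (ps_uniform c phi r eps H Hr He) as [N HN].
  pose (K := (N + L)%nat).
  assert (P1 := parseval r (conv (trunc K c) (trunc L g)) (K + L) ltac:(lra)).
  assert (P2 := parseval r g L ltac:(lra)).
  assert (PI0 := PI_RGT_0).
  assert (I1 : rsum (fun n => (Cmod (conv c g n) * r ^ n) ^ 2) L <=
    rsum (fun n => (Cmod (conv (trunc K c) (trunc L g) n) * r ^ n) ^ 2) (K + L)).
  { apply Rle_trans with (rsum (fun n => (Cmod (conv (trunc K c) (trunc L g) n) * r ^ n) ^ 2) L).
    - apply rsum_le; intros n Hn.
      rewrite (conv_local (trunc K c) c (trunc L g) g n); [lra| |];
        intros k Hk; apply trunc_lt; unfold K; lia.
    - apply rsum_mono; [lia|]; intros k; apply pow2_ge_0. }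
  eapply Rle_trans; [exact I1|].
  apply Rmult_le_reg_l with (2 * PI); [lra|].
  apply (is_RInt_scalR ((1 + eps) ^ 2)) in P2.
  match goal with |- _ <= _ * (?a * ?b) =>
    replace (2 * PI * (a * b)) with (a * (2 * PI * b)) by ring end.
  refine (is_RInt_le _ _ _ _ _ _ _ P1 P2 _); [lra|].
  intros t _; rewrite pe_conv_trunc, Cmod_mult, Rpow_mult_distr.
  apply Rmult_le_compat_r; [apply pow2_ge_0|].
  apply pow_incr; split; [apply Cmod_ge_0|].
  assert (Z : Cmod (circ r t) = r) by (apply Cmod_circ; lra).
  specialize (HN K (circ r t) ltac:(unfold K; lia) ltac:(lra)).
  specialize (B (circ r t) ltac:(lra)).
  rewrite Cmod_minus_sym in HN.
  replace (pe c (circ r t) K) with ((pe c (circ r t) K - phi (circ r t)) + phi (circ r t))%C by ring.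
  eapply Rle_trans; [apply Cmod_triangle|]; lra.
Qed.

Lemma conv_contractive c phi g L :
  ps_on 1 c phi -> (forall z, Cmod z < 1 -> Cmod (phi z) <= 1) ->
  rsum (fun n => Cmod (conv c g n) ^ 2) L <= rsum (fun n => Cmod (g n) ^ 2) L.
Proof.
  intros H B.
  set (X := rsum (fun n => Cmod (conv c g n) ^ 2) L).
  set (Y := rsum (fun n => Cmod (g n) ^ 2) L).
  assert (X0 : 0 <= X) by (apply rsum_nonneg; intros; apply pow2_ge_0).
  assert (Y0 : 0 <= Y) by (apply rsum_nonneg; intros; apply pow2_ge_0).
  (* The limit [r -> 1], [eps -> 0] is taken along [r = 1 - d], [eps = d]. By Bernoulli
     [(1 - d) ^ (2 * n) >= 1 - 2 L d] for [n < L], while [(1 + d) ^ 2 <= 1 + 3 d]. *)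
  assert (Q : forall d, 0 < d < 1 -> X * (1 - INR (2 * L) * d) <= (1 + 3 * d) * Y).
  { intros d Hd.
    assert (A := conv_contractive_aux c phi g L (1 - d) d H B ltac:(lra) ltac:(lra)).
    assert (M : forall n, (1 - d) ^ n <= 1).
    { intros n; eapply Rle_trans; [apply (pow_incr _ 1); lra|rewrite pow1; lra]. }
    assert (M0 : forall n, 0 <= (1 - d) ^ n) by (intros n; apply pow_le; lra).
    assert (Bern : forall n, 1 - INR n * d <= (1 - d) ^ n).
    { induction n as [|n IH]; [simpl; lra|]. rewrite S_INR; simpl.
      specialize (M n); nra. }
    apply Rle_trans with (rsum (fun n => (Cmod (conv c g n) * (1 - d) ^ n) ^ 2) L).
    - unfold X; rewrite Rmult_comm, <- rsum_scal; apply rsum_le; intros n Hn.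
      rewrite Rpow_mult_distr, Rmult_comm; apply Rmult_le_compat_l; [apply pow2_ge_0|].
      eapply Rle_trans; [apply Bern|].
      rewrite <- pow_mult; replace (2 * L)%nat with (n * 2 + (2 * L - n * 2))%nat by lia.
      rewrite pow_add. specialize (M (2 * L - n * 2)%nat); specialize (M0 (n * 2)%nat); nra.
    - eapply Rle_trans; [exact A|].
      apply Rmult_le_compat; [apply pow2_ge_0|apply rsum_nonneg; intros; apply pow2_ge_0|nra|].
      apply rsum_le; intros n Hn; apply pow_incr; split.
      + apply Rmult_le_pos; [apply Cmod_ge_0|auto].
      + rewrite <- (Rmult_1_r (Cmod (g n))) at 2.
        apply Rmult_le_compat_l; [apply Cmod_ge_0|auto]. }
  apply le_epsilon; intros e He.
  (* [W] exceeds the coefficient of [d] in [Q], so that [X - Y <= d * W <= e]; the added 1 keeps it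
     positive. *)
  set (W := X * INR (2 * L) + 3 * Y + 1).
  assert (W1 : 1 <= W).
  { assert (0 <= X * INR (2 * L)) by (apply Rmult_le_pos; [auto|apply pos_INR]). unfold W; lra. }
  set (d := Rmin (1/2) (e / W)).
  assert (D1 : 0 < d) by (apply Rmin_glb_lt; [lra|apply Rdiv_lt_0_compat; lra]).
  assert (D2 : d <= 1/2) by apply Rmin_l.
  assert (D3 : d * W <= e).
  { apply Rle_trans with (e / W * W); [apply Rmult_le_compat_r; [lra|apply Rmin_r]|].
    right; field; lra. }
  specialize (Q d ltac:(lra)). unfold W in D3. nra.
Qed.

(** * Uniqueness of coefficients and local regularity *)

Lemma cv_sum_plus f g a b : cv_sum f a -> cv_sum g b -> cv_sum (fun n => f n + g n)%C (a + b)%C.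
Proof.
  intros H1 H2 eps He; destruct (H1 (eps / 2)) as [N1 P1]; [lra|].
  destruct (H2 (eps / 2)) as [N2 P2]; [lra|].
  exists (N1 + N2)%nat; intros n Hn; rewrite csum_plus.
  replace (csum f n + csum g n - (a + b))%C with ((csum f n - a) + (csum g n - b))%C by ring.
  eapply Rle_lt_trans; [apply Cmod_triangle|].
  specialize (P1 n ltac:(lia)); specialize (P2 n ltac:(lia)); lra.
Qed.

Lemma cv_sum_scal k f a : cv_sum f a -> cv_sum (fun n => k * f n)%C (k * a)%C.
Proof.
  intros H eps He; assert (K := Cmod_ge_0 k).
  destruct (H (eps / (Cmod k + 1))) as [N P]; [apply Rdiv_lt_0_compat; lra|].
  exists N; intros n Hn; rewrite csum_scal.
  replace (k * csum f n - k * a)%C with (k * (csum f n - a))%C by ring.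
  rewrite Cmod_mult; specialize (P n Hn); set (x := Cmod (csum f n - a)%C) in *.
  assert (X : 0 <= x) by apply Cmod_ge_0.
  apply Rle_lt_trans with ((Cmod k + 1) * x); [nra|].
  apply Rmult_lt_compat_l with (r := Cmod k + 1) in P; [|lra].
  replace ((Cmod k + 1) * (eps / (Cmod k + 1))) with eps in P by (field; lra); exact P.
Qed.

Lemma ps_unique R1 R2 c c' phi : 0 < R1 -> 0 < R2 -> ps_on R1 c phi -> ps_on R2 c' phi ->
  forall n, c n = c' n.
Proof.
  intros P1 P2 H1 H2.
  set (R0 := Rmin R1 R2); assert (P0 : 0 < R0) by (apply Rmin_glb_lt; auto).
  pose (d := fun n => (c n + (-(1)) * c' n)%C).
  assert (Hd : ps_on R0 d (fun _ => RtoC 0)).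
  { intros z Hz.
    assert (Z1 : Cmod z < R1) by (eapply Rlt_le_trans; [exact Hz|apply Rmin_l]).
    assert (Z2 : Cmod z < R2) by (eapply Rlt_le_trans; [exact Hz|apply Rmin_r]).
    assert (Q := cv_sum_plus _ _ _ _ (H1 z Z1) (cv_sum_scal (-(1))%C _ _ (H2 z Z2))).
    replace (phi z + - (1) * phi z)%C with (RtoC 0) in Q by ring.
    revert Q; apply cv_sum_ext; intros n; unfold d; ring. }
  destruct (ps_coeff_bound R0 d _ (R0 / 2) Hd) as [B [B0 HB]]; [lra|].
  set (s := / (R0 / 2)) in *.
  assert (S0 : 0 < s) by (apply Rinv_0_lt_compat; lra).
  assert (Z : forall n, d n = RtoC 0).
  { intros n; induction n as [n IH] using lt_wf_ind.
    assert (K0 : 0 < 2 * B * s ^ S n).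
    { apply Rmult_lt_0_compat; [lra|apply pow_lt, S0]. }
    apply C_eq_eps; intros eps He; replace (d n - 0)%C with (d n) by ring.
    (* With the lower coefficients already zero, [|d n| x^n] is at most the tail [2 B (s x)^(n+1)].
       The first bound on [x] gives [s * x <= / 2], hence the 2; the second makes the quotient by
       [x^n] at most [eps]. *)
    set (x := Rmin (R0 / 4) (eps / (2 * B * s ^ S n))).
    assert (X0 : 0 < x) by (apply Rmin_glb_lt; [lra|apply Rdiv_lt_0_compat; lra]).
    assert (X1 : x <= R0 / 4) by apply Rmin_l.
    assert (X2 : 2 * B * s ^ S n * x <= eps).
    { apply Rle_trans with (2 * B * s ^ S n * (eps / (2 * B * s ^ S n))).
      - apply Rmult_le_compat_l; [lra|apply Rmin_r].
      - right; set (M := 2 * B * s ^ S n) in *; field; lra. }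
    assert (SX : 0 <= s * x <= / 2).
    { split; [nra|]. apply Rle_trans with (s * (R0 / 4)); [apply Rmult_le_compat_l; lra|].
      right; unfold s; field; lra. }
    assert (MX : Cmod (RtoC x) = x) by (rewrite Cmod_R, Rabs_pos_eq; lra).
    assert (T := cv_sum_tail_bound _ _ B (s * x) (S n) (Hd (RtoC x) ltac:(lra)) ltac:(lra) ltac:(lra)).
    rewrite csum_ext with (g := fun k => if Nat.eqb k n then (d n * RtoC x ^ n)%C else RtoC 0) in T.
    - simpl csum in T; rewrite csum_zero, Nat.eqb_refl in T.
      + replace (0 - (0 + d n * RtoC x ^ n))%C with (- (d n * RtoC x ^ n))%C in T by ring.
        rewrite Cmod_opp, Cmod_mult, Cmod_pow, MX in T.
        assert (XN : 0 < x ^ n) by (apply pow_lt, X0).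
        apply Rmult_le_reg_r with (x ^ n); [exact XN|].
        eapply Rle_trans; [apply T|].
        * intros k _; rewrite Cmod_mult, Cmod_pow, MX, Rpow_mult_distr, <- Rmult_assoc.
          apply Rmult_le_compat_r; [apply pow_le; lra|apply HB].
        * apply Rle_trans with (B * (s * x) ^ S n * 2).
          { unfold Rdiv; apply Rmult_le_compat_l.
            - apply Rmult_le_pos; [lra|apply pow_le; lra].
            - replace 2 with (/ (1 - / 2)) by field. apply Rinv_le_contravar; lra. }
          rewrite Rpow_mult_distr.
          replace (B * (s ^ S n * x ^ S n) * 2) with (2 * B * s ^ S n * x * x ^ n) by (simpl; ring).
          apply Rmult_le_compat_r; lra.
      + intros k Hk; destruct (Nat.eqb_spec k n); [lia|reflexivity].
    - intros k Hk; destruct (Nat.eqb_spec k n) as [->|Q]; [reflexivity|].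
      rewrite IH by lia; ring. }
  intros n; specialize (Z n); unfold d in Z.
  replace (c n) with ((c n + - (1) * c' n) + c' n)%C by ring; rewrite Z; ring.
Qed.

Lemma is_derive_of_quadratic (f : R -> R) x l B rho : 0 < rho ->
  (forall h, Rabs h < rho -> Rabs (f (x + h) - f x - l * h) <= B * h ^ 2) -> is_derive f x l.
Proof.
  intros Hr H; apply is_derive_Reals; intros eps He.
  assert (D0 : 0 < Rmin rho (eps / (Rabs B + 1))).
  { apply Rmin_glb_lt; [auto|apply Rdiv_lt_0_compat; [auto|assert (Q := Rabs_pos B); lra]]. }
  exists (mkposreal _ D0); intros h Hh Hd; simpl in Hd.
  assert (H1 : Rabs h < rho) by (eapply Rlt_le_trans; [exact Hd|apply Rmin_l]).
  assert (H2 : Rabs h < eps / (Rabs B + 1)) by (eapply Rlt_le_trans; [exact Hd|apply Rmin_r]).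
  specialize (H h H1).
  assert (HP : 0 < Rabs h) by (apply Rabs_pos_lt, Hh).
  assert (BP := Rabs_pos B); assert (BL := Rle_abs B).
  replace ((f (x + h) - f x) / h - l) with ((f (x + h) - f x - l * h) / h) by (field; auto).
  unfold Rdiv at 1; rewrite Rabs_mult, Rabs_inv.
  apply Rmult_lt_reg_r with (Rabs h); [exact HP|].
  rewrite Rmult_assoc, Rinv_l, Rmult_1_r by lra.
  eapply Rle_lt_trans; [exact H|].
  rewrite <- (pow2_abs h).
  apply Rmult_lt_compat_l with (r := Rabs B + 1) in H2; [|lra].
  replace ((Rabs B + 1) * (eps / (Rabs B + 1))) with eps in H2 by (field; lra).
  nra.
Qed.

(* A quantitative form of continuous complex differentiability: the second-order
   remainder is controlled uniformly near each point of the disk. *)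
Definition c1_on_disk (phi dphi : C -> C) : Prop :=
  forall z0, Cmod z0 < 1 -> exists rho B, 0 < rho /\ 0 <= B /\
    forall z z', Cmod (z - z0)%C < rho -> Cmod (z' - z0)%C < rho ->
      Cmod (phi z' - phi z - dphi z * (z' - z))%C <= B * Cmod (z' - z)%C ^ 2.

(** Reading the derivative along the real direction gives a total function, so that derivatives
    obtained from different local expansions are values of one global [dphi]; [cderive_eq] makes the
    identification. *)
Definition cderive (phi : C -> C) (z : C) : C :=
  (Derive (fun x => Re (phi (z + RtoC x)%C)) 0, Derive (fun x => Im (phi (z + RtoC x)%C)) 0).

Lemma Re_minus (x y : C) : Re (x - y)%C = Re x - Re y.
Proof. reflexivity. Qed.

Lemma Im_minus (x y : C) : Im (x - y)%C = Im x - Im y.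
Proof. reflexivity. Qed.

Lemma im_le_Cmod (z : C) : Rabs (Im z) <= Cmod z.
Proof. eapply Rle_trans; [apply Rmax_r|apply Rmax_Cmod]. Qed.

Lemma cderive_eq phi z d rho B : 0 < rho ->
  (forall z', Cmod (z' - z)%C < rho ->
     Cmod (phi z' - phi z - d * (z' - z))%C <= B * Cmod (z' - z)%C ^ 2) ->
  cderive phi z = d.
Proof.
  intros Hr H; unfold cderive.
  assert (Q : forall h, Rabs h < rho ->
    Cmod (phi (z + RtoC h) - phi z - d * RtoC h)%C <= B * h ^ 2).
  { intros h Hh; specialize (H (z + RtoC h)%C).
    replace (z + RtoC h - z)%C with (RtoC h) in H by ring.
    rewrite Cmod_R, pow2_abs in H; auto. }
  replace d with (Re d, Im d) by (destruct d; reflexivity).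
  f_equal; apply is_derive_unique; apply (is_derive_of_quadratic _ _ _ B rho Hr); intros h Hh;
    rewrite Rplus_0_l, Cplus_0_r; eapply Rle_trans; [|apply (Q h Hh)| |apply (Q h Hh)].
  - rewrite <- re_scal_r, <- !Re_minus; apply re_le_Cmod.
  - replace (Im d * h) with (Im (d * RtoC h)%C) by (rewrite im_mult; unfold Re, Im; simpl; ring).
    rewrite <- !Im_minus; apply im_le_Cmod.
Qed.

(** The factor [rho] on the left, like [rho ^ 2] in the second-order bound that follows, avoids the
    exponents [n - 1] and [n - 2], which are wrong for small [n] in [nat]. *)
Lemma pow_diff_bound (u v : C) rho n : 0 < rho -> Cmod u <= rho -> Cmod v <= rho ->
  rho * Cmod (v ^ n - u ^ n)%C <= INR n * rho ^ n * Cmod (v - u)%C.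
Proof.
  intros Hr Hu Hv; induction n as [|n IH].
  - simpl; replace (1 - 1)%C with (RtoC 0) by ring; rewrite Cmod_0; lra.
  - rewrite !Cpow_S; replace (v * v ^ n - u * u ^ n)%C with (v * (v ^ n - u ^ n) + (v - u) * u ^ n)%C by ring.
    assert (X := Cmod_ge_0 (v - u)%C); assert (Y := Cmod_ge_0 (v ^ n - u ^ n)%C).
    apply Rle_trans with (rho * (rho * Cmod (v ^ n - u ^ n)%C + Cmod (v - u)%C * rho ^ n)).
    + apply Rmult_le_compat_l; [lra|]. eapply Rle_trans; [apply Cmod_triangle|].
      rewrite !Cmod_mult, Cmod_pow; apply Rplus_le_compat.
      * apply Rmult_le_compat_r; auto.
      * apply Rmult_le_compat_l; auto; apply pow_incr; split; [apply Cmod_ge_0|auto].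
    + rewrite S_INR; simpl pow. nra.
Qed.

Lemma pow_taylor2_bound (u v : C) rho n : 0 < rho -> Cmod u <= rho -> Cmod v <= rho ->
  rho ^ 2 * Cmod (v ^ n - u ^ n - INR n * u ^ pred n * (v - u))%C
    <= INR n ^ 2 * rho ^ n * Cmod (v - u)%C ^ 2.
Proof.
  intros Hr Hu Hv; induction n as [|n IH].
  - simpl; replace (1 - 1 - 0 * 1 * (v - u))%C with (RtoC 0) by ring; rewrite Cmod_0; lra.
  - replace (v ^ S n - u ^ S n - INR (S n) * u ^ pred (S n) * (v - u))%C
      with (u * (v ^ n - u ^ n - INR n * u ^ pred n * (v - u)) + (v - u) * (v ^ n - u ^ n))%C.
    + assert (D := pow_diff_bound u v rho n Hr Hu Hv).
      set (E := Cmod (v ^ n - u ^ n - INR n * u ^ pred n * (v - u))%C) in *.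
      set (F := Cmod (v ^ n - u ^ n)%C) in *.
      set (x := Cmod (v - u)%C) in *.
      assert (X : 0 <= x) by apply Cmod_ge_0.
      assert (P : 0 < rho ^ n) by (apply pow_lt, Hr). assert (N := pos_INR n).
      apply Rle_trans with (rho ^ 2 * (rho * E + x * F)).
      * apply Rmult_le_compat_l; [apply pow2_ge_0|].
        eapply Rle_trans; [apply Cmod_triangle|]; rewrite !Cmod_mult; fold E F x.
        apply Rplus_le_compat_r, Rmult_le_compat_r; [apply Cmod_ge_0|auto].
      * rewrite S_INR; change (rho ^ S n) with (rho * rho ^ n).
        apply Rmult_le_compat_l with (r := rho) in IH; [|lra].
        apply Rmult_le_compat_l with (r := rho * x) in D; [|apply Rmult_le_pos; lra].
        assert (0 <= rho * rho ^ n * x ^ 2).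
        { apply Rmult_le_pos; [|apply pow2_ge_0]. apply Rmult_le_pos; lra. }
        nra.
    + rewrite S_INR, RtoC_plus; simpl pred.
      assert (U : (INR n * (u * u ^ pred n) = INR n * u ^ n)%C).
      { destruct n as [|n]; [simpl; ring|reflexivity]. }
      transitivity (v ^ n * v - u * u ^ n - (INR n * (u * u ^ pred n) + u ^ n) * (v - u))%C;
        [ring|rewrite U, !Cpow_S; ring].
Qed.

Lemma INR_le_pow2 n : INR n <= 2 ^ n.
Proof.
  induction n as [|n IH]; [simpl; lra|]. rewrite S_INR; simpl.
  assert (1 <= 2 ^ n) by (apply pow_R1_Rle; lra); lra.
Qed.

Lemma analytic_c1 phi : analytic_on_disk phi -> c1_on_disk phi (cderive phi).
Proof.
  intros H z0 Hz0; destruct (H z0 Hz0) as [r [Hr [c Hc]]].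
  assert (P : ps_on r c (fun u => phi (z0 + u)%C)).
  { intros u Hu; specialize (Hc (z0 + u)%C).
    replace (z0 + u - z0)%C with u in Hc by ring; specialize (Hc Hu).
    apply is_series_cv_sum in Hc; revert Hc; apply cv_sum_ext; intros n; f_equal; apply cpow_Cpow. }
  destruct (ps_coeff_bound r c _ (r / 2) P) as [K [K0 HK]]; [lra|].
  set (s := / (r / 2)) in *; assert (S0 : 0 < s) by (apply Rinv_0_lt_compat; lra).
  (* Differentiating twice costs [INR k ^ 2 <= 4 ^ k]; against [(s * rho) ^ k = (/ 8) ^ k] a
     geometric series of ratio [/ 2] remains. *)
  set (rho := / (8 * s)); assert (R0 : 0 < rho) by (apply Rinv_0_lt_compat; lra).
  assert (SR : s * rho = / 8) by (unfold rho; field; lra).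
  assert (RR : rho < r) by (unfold rho, s; rewrite Rinv_mult, Rinv_inv; lra).
  assert (SRn : forall n, s ^ n * rho ^ n = (/ 8) ^ n)
    by (intros n; rewrite <- Rpow_mult_distr, SR; reflexivity).
  assert (P8 : forall n, 0 <= (/ 8) ^ n) by (intros n; apply pow_le; lra).
  set (B := K / rho ^ 2 * 2).
  assert (R2 : 0 < rho ^ 2) by (apply pow_lt, R0).
  assert (B0 : 0 <= B) by (unfold B; assert (0 < K / rho ^ 2) by (apply Rdiv_lt_0_compat; lra); lra).
  assert (D : forall u, Cmod u < rho -> exists d, forall v, Cmod v < rho ->
    Cmod (phi (z0 + v) - phi (z0 + u) - d * (v - u))%C <= B * Cmod (v - u)%C ^ 2).
  { intros u Hu.
    destruct (ex_cv_sum_geom (fun n => c n * (INR n * u ^ pred n))%C (K / rho) (/ 4)) as [d Hd]; [lra| |].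
    { intros [|n]; rewrite !Cmod_mult, Cmod_pow, Cmod_R, Rabs_pos_eq by apply pos_INR.
      { simpl; assert (0 < K / rho) by (apply Rdiv_lt_0_compat; lra); lra. }
      simpl pred; apply Rle_trans with (K * s ^ S n * (2 ^ S n * rho ^ n)).
      - apply Rmult_le_compat; [apply Cmod_ge_0| |apply HK|].
        + apply Rmult_le_pos; [apply pos_INR|apply pow_le, Cmod_ge_0].
        + apply Rmult_le_compat; [apply pos_INR|apply pow_le, Cmod_ge_0|apply INR_le_pow2|].
          apply pow_incr; split; [apply Cmod_ge_0|lra].
      - right; replace (K * s ^ S n * (2 ^ S n * rho ^ n))
          with (K / rho * (2 ^ S n * (s ^ S n * rho ^ S n))) by (simpl; field; lra).
        rewrite SRn, <- Rpow_mult_distr; do 2 f_equal; lra. }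
    exists d; intros v Hv.
    assert (L := cv_sum_plus _ _ _ _ (cv_sum_plus _ _ _ _ (P v ltac:(lra))
      (cv_sum_scal (-(1))%C _ _ (P u ltac:(lra)))) (cv_sum_scal (- (v - u))%C _ _ Hd)).
    set (l := (phi (z0 + v) + - (1) * phi (z0 + u) + - (v - u) * d)%C) in L.
    replace (phi (z0 + v) - phi (z0 + u) - d * (v - u))%C with (l - 0)%C by (unfold l; ring).
    apply (cv_sum_limit_bound _ _ _ _ O L); intros n _.
    rewrite (csum_ext _ (fun k => c k * (v ^ k - u ^ k - INR k * u ^ pred k * (v - u)))%C)
      by (intros; ring).
    set (x := Cmod (v - u)%C).
    assert (X2 : 0 <= x ^ 2) by apply pow2_ge_0.
    rewrite <- (Cplus_0_r (csum _ n)); replace (csum _ n + 0 - 0)%C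
      with (csum (fun k => c k * (v ^ k - u ^ k - INR k * u ^ pred k * (v - u)))%C n) by ring.
    eapply Rle_trans; [apply Cmod_csum_le|].
    apply Rle_trans with (rsum (fun k => K / rho ^ 2 * x ^ 2 * (/ 2) ^ k) n).
    - apply rsum_le; intros k _; rewrite Cmod_mult.
      assert (T := pow_taylor2_bound u v rho k R0 ltac:(lra) ltac:(lra)); fold x in T.
      set (E := Cmod (v ^ k - u ^ k - INR k * u ^ pred k * (v - u))%C) in *.
      assert (E0 : 0 <= E) by apply Cmod_ge_0.
      apply Rle_trans with (K * s ^ k * E); [apply Rmult_le_compat_r; auto|].
      apply Rmult_le_reg_l with (rho ^ 2); [exact R2|].
      replace (rho ^ 2 * (K / rho ^ 2 * x ^ 2 * (/ 2) ^ k)) with (K * x ^ 2 * (/ 2) ^ k) by (field; lra).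
      apply Rle_trans with (K * s ^ k * (INR k ^ 2 * rho ^ k * x ^ 2)).
      + replace (rho ^ 2 * (K * s ^ k * E)) with (K * s ^ k * (rho ^ 2 * E)) by ring.
        apply Rmult_le_compat_l; [|exact T]. apply Rmult_le_pos; [lra|apply pow_le; lra].
      + replace (K * s ^ k * (INR k ^ 2 * rho ^ k * x ^ 2))
          with (K * x ^ 2 * (INR k ^ 2 * (s ^ k * rho ^ k))) by ring.
        rewrite SRn; apply Rmult_le_compat_l; [apply Rmult_le_pos; lra|].
        replace ((/ 2) ^ k) with ((2 ^ k) ^ 2 * (/ 8) ^ k).
        * apply Rmult_le_compat_r; [auto|]. apply pow_incr; split; [apply pos_INR|apply INR_le_pow2].
        * rewrite <- pow_mult, Nat.mul_comm, pow_mult, <- Rpow_mult_distr; f_equal; lra.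
    - rewrite rsum_scal. assert (G := rsum_geom (/ 2) n ltac:(lra)).
      replace (/ (1 - / 2)) with 2 in G by field.
      unfold B; assert (0 <= K / rho ^ 2) by (left; apply Rdiv_lt_0_compat; lra).
      replace (K / rho ^ 2 * 2 * x ^ 2) with (K / rho ^ 2 * x ^ 2 * 2) by ring.
      apply Rmult_le_compat_l; [apply Rmult_le_pos; auto|exact G]. }
  exists rho, B; split; [exact R0|split; [exact B0|]].
  intros z z' Hz Hz'.
  destruct (D (z - z0)%C Hz) as [d Hd].
  assert (Q : forall y, Cmod (y - z0)%C < rho ->
    Cmod (phi y - phi z - d * (y - z))%C <= B * Cmod (y - z)%C ^ 2).
  { intros y Hy; specialize (Hd (y - z0)%C Hy).
    replace (z0 + (y - z0))%C with y in Hd by ring; replace (z0 + (z - z0))%C with z in Hd by ring.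
    replace (y - z0 - (z - z0))%C with (y - z)%C in Hd by ring; exact Hd. }
  (* This radius keeps the disk around [z] inside the disk around [z0] on which [Q] holds. *)
  rewrite (cderive_eq phi z d (rho - Cmod (z - z0)%C) B); [apply Q, Hz'|lra|].
  intros y Hy; apply Q. eapply Rle_lt_trans; [apply (Cmod_minus_triangle _ z)|]; lra.
Qed.

(** * Cauchy's formula and the Taylor series on the disk *)

Lemma Cmod_le_parts (z : C) e : Rabs (Re z) <= e -> Rabs (Im z) <= e -> Cmod z <= 2 * e.
Proof.
  intros H1 H2; replace z with ((Re z, 0) + (0, Im z))%C
    by (destruct z; unfold Cplus; simpl; f_equal; ring).
  eapply Rle_trans; [apply Cmod_triangle|].
  assert (A : forall x, Cmod (x, 0) = Rabs x) by exact Cmod_R.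
  assert (B : forall x, Cmod (0, x) = Rabs x).
  { intros x; replace (0, x) with (Ci * RtoC x)%C
      by (unfold Ci, RtoC, Cmult; simpl; f_equal; ring).
    rewrite Cmod_mult, Cmod_Ci, Cmod_R; ring. }
  rewrite A, B; lra.
Qed.

Lemma is_derive_increment (f : R -> R) x l eps : is_derive f x l -> 0 < eps ->
  exists d, 0 < d /\ forall h, Rabs h < d -> Rabs (f (x + h) - f x - l * h) <= eps * Rabs h.
Proof.
  intros H He; apply is_derive_Reals in H; destruct (H eps He) as [[d D] Hd]; simpl in Hd.
  exists d; split; [exact D|]; intros h Hh.
  destruct (Req_dec h 0) as [->|Z].
  - rewrite Rplus_0_r, Rabs_R0; replace (f x - f x - l * 0) with 0 by ring; rewrite Rabs_R0; lra.
  - specialize (Hd h Z Hh).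
    replace (f (x + h) - f x - l * h) with (((f (x + h) - f x) / h - l) * h) by (field; auto).
    rewrite Rabs_mult; apply Rmult_le_compat_r; [apply Rabs_pos|lra].
Qed.

(** The velocity of a plane curve with a real parameter, as opposed to the complex derivative
    [cderive]. *)
Definition is_cderive (g : R -> C) (x : R) (l : C) : Prop :=
  is_derive (fun t => Re (g t)) x (Re l) /\ is_derive (fun t => Im (g t)) x (Im l).

Lemma is_cderive_increment g x l eps : is_cderive g x l -> 0 < eps ->
  exists d, 0 < d /\ forall h, Rabs h < d -> Cmod (g (x + h)%R - g x - l * RtoC h)%C <= eps * Rabs h.
Proof.
  intros [H1 H2] He.
  destruct (is_derive_increment _ _ _ (eps / 2) H1) as [d1 [D1 P1]]; [lra|].
  destruct (is_derive_increment _ _ _ (eps / 2) H2) as [d2 [D2 P2]]; [lra|].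
  exists (Rmin d1 d2); split; [apply Rmin_glb_lt; auto|]; intros h Hh.
  specialize (P1 h (Rlt_le_trans _ _ _ Hh (Rmin_l _ _))).
  specialize (P2 h (Rlt_le_trans _ _ _ Hh (Rmin_r _ _))).
  replace (eps * Rabs h) with (2 * (eps / 2 * Rabs h)) by field.
  apply Cmod_le_parts; rewrite ?Re_minus, ?Im_minus.
  - rewrite re_scal_r; exact P1.
  - replace (Im (l * RtoC h)) with (Im l * h) by (rewrite im_mult; unfold Re, Im; simpl; ring).
    exact P2.
Qed.

Lemma is_cderive_of_increment g x l :
  (forall eps, 0 < eps -> exists d, 0 < d /\
     forall h, Rabs h < d -> Cmod (g (x + h)%R - g x - l * RtoC h)%C <= eps * Rabs h) ->
  is_cderive g x l.
Proof.
  intros H.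
  assert (Q : forall (f : R -> R) m, (forall h, Rabs (f (x + h) - f x - m * h)
      <= Cmod (g (x + h)%R - g x - l * RtoC h)%C) -> is_derive f x m).
  { intros f m Hf; apply is_derive_Reals; intros eps He.
    destruct (H (eps / 2)) as [d [D P]]; [lra|].
    exists (mkposreal d D); intros h Hh Hd; simpl in Hd.
    assert (HP : 0 < Rabs h) by (apply Rabs_pos_lt, Hh).
    replace ((f (x + h) - f x) / h - m) with ((f (x + h) - f x - m * h) / h) by (field; auto).
    unfold Rdiv at 1; rewrite Rabs_mult, Rabs_inv.
    apply Rmult_lt_reg_r with (Rabs h); [exact HP|].
    rewrite Rmult_assoc, Rinv_l, Rmult_1_r by lra.
    eapply Rle_lt_trans; [apply Hf|]; eapply Rle_lt_trans; [apply P, Hd|]; nra. }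
  split; apply Q; intros h.
  - rewrite <- re_scal_r, <- !Re_minus; apply re_le_Cmod.
  - replace (Im l * h) with (Im (l * RtoC h)%C) by (rewrite im_mult; unfold Re, Im; simpl; ring).
    rewrite <- !Im_minus; apply im_le_Cmod.
Qed.

Lemma is_cderive_comp phi dphi g x l : c1_on_disk phi dphi -> Cmod (g x) < 1 ->
  is_cderive g x l -> is_cderive (fun t => phi (g t)) x (dphi (g x) * l)%C.
Proof.
  intros HD Hg H; apply is_cderive_of_increment; intros eps He.
  destruct (HD (g x) Hg) as [rho [B [R0 [B0 P]]]].
  set (D := Cmod (dphi (g x))); assert (D0 : 0 <= D) by apply Cmod_ge_0.
  (* [M] bounds the difference quotients of [g], whose first-order error is kept below 1. Half of
     [eps] is spent on that error multiplied by [dphi], half on the quadratic remainder of [phi]. *)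
  set (M := Cmod l + 1); assert (M0 : 1 <= M) by (assert (Q := Cmod_ge_0 l); unfold M; lra).
  assert (E1 : 0 < Rmin 1 (eps / (2 * (D + 1)))).
  { apply Rmin_glb_lt; [lra|apply Rdiv_lt_0_compat; lra]. }
  destruct (is_cderive_increment g x l _ H E1) as [d1 [D1 P1]].
  set (d := Rmin d1 (Rmin (rho / M) (eps / (2 * (B * M ^ 2 + 1))))).
  assert (BM : 0 <= B * M ^ 2) by (apply Rmult_le_pos; [auto|apply pow2_ge_0]).
  exists d; split.
  { repeat apply Rmin_glb_lt; auto; apply Rdiv_lt_0_compat; lra. }
  intros h Hh.
  assert (H1 : Rabs h < d1) by (eapply Rlt_le_trans; [exact Hh|apply Rmin_l]).
  assert (H2 : Rabs h < rho / M).
  { eapply Rlt_le_trans; [exact Hh|]; eapply Rle_trans; [apply Rmin_r|apply Rmin_l]. }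
  assert (H3 : Rabs h < eps / (2 * (B * M ^ 2 + 1))).
  { eapply Rlt_le_trans; [exact Hh|]; eapply Rle_trans; [apply Rmin_r|apply Rmin_r]. }
  specialize (P1 h H1).
  set (e := Rmin 1 (eps / (2 * (D + 1)))) in *.
  assert (L1 : e <= 1) by apply Rmin_l.
  assert (L2 : D * e <= eps / 2).
  { apply Rle_trans with (D * (eps / (2 * (D + 1)))); [apply Rmult_le_compat_l; [auto|apply Rmin_r]|].
    apply Rmult_le_reg_r with (2 * (D + 1)); [lra|].
    replace (D * (eps / (2 * (D + 1))) * (2 * (D + 1))) with (D * eps) by (field; lra). nra. }
  assert (A0 := Rabs_pos h).
  set (dg := (g (x + h)%R - g x)%C) in *.
  assert (G1 : Cmod dg <= M * Rabs h).
  { replace dg with ((dg - l * RtoC h) + l * RtoC h)%C by ring.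
    eapply Rle_trans; [apply Cmod_triangle|]. rewrite Cmod_mult, Cmod_R; unfold M; nra. }
  assert (G2 : Cmod dg < rho).
  { eapply Rle_lt_trans; [exact G1|].
    apply Rmult_lt_compat_l with (r := M) in H2; [|lra].
    replace (M * (rho / M)) with rho in H2 by (field; lra); exact H2. }
  specialize (P (g x) (g (x + h)%R)).
  fold dg in P; replace (g x - g x)%C with (RtoC 0) in P by ring; rewrite Cmod_0 in P.
  specialize (P R0 G2).
  replace (phi (g (x + h)%R) - phi (g x) - dphi (g x) * l * RtoC h)%C with
    ((phi (g (x + h)%R) - phi (g x) - dphi (g x) * dg) + dphi (g x) * (dg - l * RtoC h))%C by ring.
  eapply Rle_trans; [apply Cmod_triangle|]; rewrite Cmod_mult; fold D.
  assert (Q1 : B * Cmod dg ^ 2 <= eps / 2 * Rabs h).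
  { apply Rle_trans with (B * (M * Rabs h) ^ 2).
    - apply Rmult_le_compat_l; [auto|]; apply pow_incr; split; [apply Cmod_ge_0|auto].
    - replace (B * (M * Rabs h) ^ 2) with (B * M ^ 2 * Rabs h * Rabs h) by ring.
      apply Rmult_le_compat_r; [auto|].
      apply Rmult_lt_compat_l with (r := 2 * (B * M ^ 2 + 1)) in H3; [|lra].
      replace (2 * (B * M ^ 2 + 1) * (eps / (2 * (B * M ^ 2 + 1)))) with eps in H3 by (field; lra).
      nra. }
  assert (Q2 : D * Cmod (dg - l * RtoC h)%C <= eps / 2 * Rabs h).
  { apply Rle_trans with (D * (e * Rabs h)); [apply Rmult_le_compat_l; auto|].
    rewrite <- Rmult_assoc; apply Rmult_le_compat_r; auto. }
  lra.
Qed.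

Lemma is_cderive_Re_mult lam g x l : is_cderive g x l ->
  is_derive (fun t => Re (lam * g t)%C) x (Re (lam * l)%C).
Proof.
  intros [H1 H2].
  apply (is_derive_ext (fun t => Re lam * Re (g t) - Im lam * Im (g t)));
    [intros t; symmetry; apply re_mult|rewrite re_mult].
  apply (is_derive_minus (V := R_NormedModule)); apply is_derive_scal; assumption.
Qed.

(** Adding the expansion of [phi] from [z] to [z0] and the one from [z0] to [z] cancels the values
    of [phi] and leaves [(dphi z - dphi z0) * (z - z0)] against two quadratic remainders. *)
Lemma c1_dphi_continuous phi dphi z0 : c1_on_disk phi dphi -> Cmod z0 < 1 ->
  exists rho L, 0 < rho /\ 0 <= L /\
  forall z, Cmod (z - z0)%C < rho -> Cmod (dphi z - dphi z0)%C <= L * Cmod (z - z0)%C.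
Proof.
  intros HD Hz; destruct (HD z0 Hz) as [rho [B [R0 [B0 P]]]].
  exists rho, (2 * B); split; [auto|split; [lra|]]; intros z Hr.
  assert (Z0 : Cmod (z0 - z0)%C < rho) by (replace (z0 - z0)%C with (RtoC 0) by ring; rewrite Cmod_0; auto).
  assert (P1 := P z z0 Hr Z0); assert (P2 := P z0 z Z0 Hr).
  rewrite (Cmod_minus_sym z0 z) in P1.
  set (x := (z - z0)%C) in *.
  destruct (Req_dec (Cmod x) 0) as [E|E].
  { rewrite E; apply Cmod_eq_0 in E.
    replace z with (x + z0)%C by (unfold x; ring); rewrite E.
    replace (dphi (0 + z0) - dphi z0)%C with (RtoC 0) by (rewrite Cplus_0_l; ring).
    rewrite Cmod_0; lra. }
  assert (X : 0 < Cmod x) by (assert (Q := Cmod_ge_0 x); lra).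
  apply Rmult_le_reg_r with (Cmod x); [exact X|].
  rewrite <- Cmod_mult.
  replace ((dphi z - dphi z0) * x)%C with
    ((phi z0 - phi z - dphi z * (z0 - z)) + (phi z - phi z0 - dphi z0 * x))%C
    by (unfold x; ring).
  eapply Rle_trans; [apply Cmod_triangle|]; nra.
Qed.

Lemma continuity_2d_pt_cfun (F : C -> R) (g : R -> R -> C) x y L rho :
  0 < rho -> 0 <= L ->
  (forall z, Cmod (z - g x y)%C < rho -> Rabs (F z - F (g x y)) <= L * Cmod (z - g x y)%C) ->
  continuity_2d_pt (fun u v => Re (g u v)) x y -> continuity_2d_pt (fun u v => Im (g u v)) x y ->
  continuity_2d_pt (fun u v => F (g u v)) x y.
Proof.
  intros R0 L0 HF C1 C2 eps.
  assert (E0 : 0 < Rmin (rho / 3) (eps / (3 * (L + 1)))).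
  { assert (Q := cond_pos eps). apply Rmin_glb_lt; apply Rdiv_lt_0_compat; lra. }
  destruct (C1 (mkposreal _ E0)) as [d1 P1]; destruct (C2 (mkposreal _ E0)) as [d2 P2]; simpl in P1, P2.
  assert (D0 : 0 < Rmin d1 d2) by (apply Rmin_glb_lt; apply cond_pos).
  exists (mkposreal _ D0); intros u v Hu Hv; simpl in Hu, Hv.
  specialize (P1 u v (Rlt_le_trans _ _ _ Hu (Rmin_l _ _)) (Rlt_le_trans _ _ _ Hv (Rmin_l _ _))).
  specialize (P2 u v (Rlt_le_trans _ _ _ Hu (Rmin_r _ _)) (Rlt_le_trans _ _ _ Hv (Rmin_r _ _))).
  set (e := Rmin (rho / 3) (eps / (3 * (L + 1)))) in *.
  assert (M : Cmod (g u v - g x y)%C <= 2 * e).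
  { apply Cmod_le_parts; [rewrite Re_minus|rewrite Im_minus]; lra. }
  assert (L1 : e <= rho / 3) by apply Rmin_l.
  assert (L2 : e * (3 * (L + 1)) <= eps).
  { apply Rle_trans with (eps / (3 * (L + 1)) * (3 * (L + 1)));
      [apply Rmult_le_compat_r; [lra|apply Rmin_r]|right; field; lra]. }
  eapply Rle_lt_trans; [apply HF; lra|]. nra.
Qed.

Lemma continuity_2d_pt_continuous (f : R -> R -> R) x y :
  continuity_2d_pt f x y -> continuous (f x) y.
Proof.
  intros H; apply continuity_pt_filterlim; intros eps He.
  destruct (H (mkposreal eps He)) as [d P]; exists d; split; [apply cond_pos|].
  intros v [_ Hv]; apply P; [|exact Hv].
  replace (x - x) with 0 by ring; rewrite Rabs_R0; apply cond_pos.
Qed.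

(** * Segments from an interior point to the circle *)

Definition seg (w : C) (r s t : R) : C := (w + RtoC s * (circ r t - w))%C.

Lemma seg_Re w r s t : Re (seg w r s t) = Re w + s * (r * cos t - Re w).
Proof. unfold seg, circ, Re; simpl; ring. Qed.

Lemma seg_Im w r s t : Im (seg w r s t) = Im w + s * (r * sin t - Im w).
Proof. unfold seg, circ, Im; simpl; ring. Qed.

(** The parameter may leave [[0, 1]] slightly, so that derivatives at the ends are two-sided: at
    [s0] the point has modulus at most [r], and the displacement is at most
    [2 r |s - s0| < r (1 - r)]. *)
Lemma seg_in_disk w r s0 s t : Cmod w < r -> 0 < r < 1 -> 0 <= s0 <= 1 ->
  Rabs (s - s0) < (1 - r) / 2 -> Cmod (seg w r s t) < 1.
Proof.
  intros Hw Hr Hs Hd; assert (W := Cmod_ge_0 w).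
  replace (seg w r s t) with (((RtoC (1 - s0)) * w + RtoC s0 * circ r t) + RtoC (s - s0) * (circ r t - w))%C
    by (unfold seg; rewrite !RtoC_minus; ring).
  eapply Rle_lt_trans; [apply Cmod_triangle|].
  assert (A : Cmod (RtoC (1 - s0) * w + RtoC s0 * circ r t)%C <= r).
  { eapply Rle_trans; [apply Cmod_triangle|].
    rewrite !Cmod_mult, !Cmod_R, Cmod_circ, !Rabs_pos_eq by lra. nra. }
  assert (B : Cmod (circ r t - w)%C <= 2 * r).
  { unfold Cminus; eapply Rle_trans; [apply Cmod_triangle|]; rewrite Cmod_opp, Cmod_circ; lra. }
  rewrite Cmod_mult, Cmod_R.
  assert (Q := Rabs_pos (s - s0)); assert (Q2 := Cmod_ge_0 (circ r t - w)%C). nra.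
Qed.

Lemma seg_derive_s w r s t : is_cderive (fun u => seg w r u t) s (circ r t - w)%C.
Proof.
  split.
  - apply (is_derive_ext (fun u => Re w + u * (r * cos t - Re w)));
      [intros u; symmetry; apply seg_Re|].
    auto_derive; [exact I|]. unfold circ, Re; simpl; ring.
  - apply (is_derive_ext (fun u => Im w + u * (r * sin t - Im w)));
      [intros u; symmetry; apply seg_Im|].
    auto_derive; [exact I|]. unfold circ, Im; simpl; ring.
Qed.

Lemma seg_derive_t w r s t : is_cderive (fun v => seg w r s v) t (RtoC s * Ci * circ r t)%C.
Proof.
  split.
  - apply (is_derive_ext (fun v => Re w + s * (r * cos v - Re w)));
      [intros u; symmetry; apply seg_Re|].
    auto_derive; [exact I|]. unfold circ, Re; simpl; ring.
  - apply (is_derive_ext (fun v => Im w + s * (r * sin v - Im w)));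
      [intros u; symmetry; apply seg_Im|].
    auto_derive; [exact I|]. unfold circ, Im; simpl; ring.
Qed.

Lemma continuity_2d_trig (f : R -> R) (k b x y : R) : (forall t, ex_derive f t) ->
  continuity_2d_pt (fun u v => b + u * (k * f v - b)) x y.
Proof.
  intros H.
  assert (C : continuity_2d_pt (fun _ v => f v) x y).
  { apply (continuity_1d_2d_pt_comp f (fun _ v => v)); [|apply continuity_2d_pt_id2].
    apply derivable_continuous_pt, ex_derive_Reals_0, H. }
  apply continuity_2d_pt_plus; [apply continuity_2d_pt_const|].
  apply continuity_2d_pt_mult; [apply continuity_2d_pt_id1|].
  apply continuity_2d_pt_minus; [|apply continuity_2d_pt_const].
  apply continuity_2d_pt_mult; [apply continuity_2d_pt_const|exact C].
Qed.

Lemma ex_derive_cos t : ex_derive cos t.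
Proof. auto_derive; exact I. Qed.

Lemma ex_derive_sin t : ex_derive sin t.
Proof. auto_derive; exact I. Qed.

Lemma seg_integrand_continuous phi dphi lam w r s t : c1_on_disk phi dphi ->
  Cmod (seg w r s t) < 1 ->
  continuity_2d_pt (fun u v => Re (lam * dphi (seg w r u v) * circ r v)%C) s t.
Proof.
  intros HD Hs.
  destruct (c1_dphi_continuous phi dphi _ HD Hs) as [rho [L [R0 [L0 P]]]].
  assert (S1 : continuity_2d_pt (fun u v => Re (seg w r u v)) s t).
  { apply (continuity_2d_pt_ext (fun u v => Re w + u * (r * cos v - Re w)));
      [intros; symmetry; apply seg_Re|apply continuity_2d_trig, ex_derive_cos]. }
  assert (S2 : continuity_2d_pt (fun u v => Im (seg w r u v)) s t).
  { apply (continuity_2d_pt_ext (fun u v => Im w + u * (r * sin v - Im w)));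
      [intros; symmetry; apply seg_Im|apply continuity_2d_trig, ex_derive_sin]. }
  assert (M0 : 0 <= Cmod lam * L) by (apply Rmult_le_pos; [apply Cmod_ge_0|auto]).
  assert (Q : forall z, Cmod (z - seg w r s t)%C < rho ->
    Cmod (lam * dphi z - lam * dphi (seg w r s t))%C <= Cmod lam * L * Cmod (z - seg w r s t)%C).
  { intros z Hz; replace (lam * dphi z - lam * dphi (seg w r s t))%C
      with (lam * (dphi z - dphi (seg w r s t)))%C by ring.
    rewrite Cmod_mult, Rmult_assoc; apply Rmult_le_compat_l; [apply Cmod_ge_0|apply P, Hz]. }
  assert (C1 : continuity_2d_pt (fun u v => Re (lam * dphi (seg w r u v))%C) s t).
  { apply (continuity_2d_pt_cfun (fun z => Re (lam * dphi z)%C) (seg w r) s t (Cmod lam * L) rho); auto.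
    intros z Hz; rewrite <- Re_minus; eapply Rle_trans; [apply re_le_Cmod|apply Q, Hz]. }
  assert (C2 : continuity_2d_pt (fun u v => Im (lam * dphi (seg w r u v))%C) s t).
  { apply (continuity_2d_pt_cfun (fun z => Im (lam * dphi z)%C) (seg w r) s t (Cmod lam * L) rho); auto.
    intros z Hz; rewrite <- Im_minus; eapply Rle_trans; [apply im_le_Cmod|apply Q, Hz]. }
  assert (T1 : continuity_2d_pt (fun _ v => 0 + 1 * (r * cos v - 0)) s t).
  { apply (continuity_2d_pt_ext (fun u v => 0 + 1 * (r * cos v - 0))); [reflexivity|].
    apply (continuity_1d_2d_pt_comp (fun v => 0 + 1 * (r * cos v - 0)) (fun _ v => v));
      [|apply continuity_2d_pt_id2].
    apply derivable_continuous_pt, ex_derive_Reals_0; auto_derive; exact I. }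
  assert (T2 : continuity_2d_pt (fun _ v => 0 + 1 * (r * sin v - 0)) s t).
  { apply (continuity_1d_2d_pt_comp (fun v => 0 + 1 * (r * sin v - 0)) (fun _ v => v));
      [|apply continuity_2d_pt_id2].
    apply derivable_continuous_pt, ex_derive_Reals_0; auto_derive; exact I. }
  apply (continuity_2d_pt_ext (fun u v => Re (lam * dphi (seg w r u v))%C * (0 + 1 * (r * cos v - 0))
     - Im (lam * dphi (seg w r u v))%C * (0 + 1 * (r * sin v - 0)))).
  - intros u v; rewrite (re_mult (lam * dphi (seg w r u v)) (circ r v)).
    change (Re (circ r v)) with (r * cos v); change (Im (circ r v)) with (r * sin v); real_eq; ring.
  - apply continuity_2d_pt_minus; apply continuity_2d_pt_mult; assumption.
Qed.

(* The derivative in [s] of the Cauchy integrand integrates to zero since, up to the factor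
   [i s], it is also the derivative in [t] of [phi (seg w r s t)]. *)
Lemma is_RInt_seg_derivative phi dphi lam w r s : c1_on_disk phi dphi ->
  Cmod w < r -> 0 < r < 1 -> 0 <= s <= 1 ->
  is_RInt (fun t => Re (lam * dphi (seg w r s t) * circ r t)%C) 0 (2 * PI) 0.
Proof.
  intros HD Hw Hr Hs.
  assert (IN : forall t, Cmod (seg w r s t) < 1).
  { intros t; apply (seg_in_disk w r s); auto.
    replace (s - s) with 0 by ring; rewrite Rabs_R0; lra. }
  (* The antiderivative carries the factor [/ s]; at [s = 0] the integrand is instead a constant
     multiple of [circ r t]. *)
  destruct (Req_dec s 0) as [->|Z].
  - apply (is_RInt_ext (fun t => Re ((lam * dphi w) * circ r t ^ 1)%C)).
    + intros t _; do 2 f_equal; [do 2 f_equal; unfold seg; ring|apply Cpow_1_r].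
    + apply is_RInt_circ_pow; lia.
  - pose (F := fun t => Re (((- Ci * RtoC (/ s)) * lam) * phi (seg w r s t))%C).
    eapply is_RInt_eq.
    + apply (is_RInt_derive (V := R_CompleteNormedModule) F).
      * intros t _; unfold F.
        assert (D := is_cderive_Re_mult ((- Ci * RtoC (/ s)) * lam)%C _ _ _
          (is_cderive_comp phi dphi (fun v => seg w r s v) t _ HD (IN t) (seg_derive_t w r s t))).
        cbv beta in D; revert D; match goal with |- is_derive _ _ ?a -> is_derive _ _ ?b =>
          replace a with b; [intros D; exact D|] end.
        f_equal.
        transitivity ((- (Ci * Ci)) * (RtoC (/ s) * RtoC s) * (lam * dphi (seg w r s t) * circ r t))%C; [|ring].
        rewrite <- RtoC_mult, Rinv_l by auto.
        replace (- (Ci * Ci))%C with (RtoC 1) by (unfold Ci, Cmult, Copp, RtoC; simpl; f_equal; ring).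
        ring.
      * intros t _; apply (continuity_2d_pt_continuous
          (fun u v => Re (lam * dphi (seg w r u v) * circ r v)%C)).
        apply (seg_integrand_continuous phi); auto.
    + unfold F; assert (E : seg w r s (2 * PI) = seg w r s 0).
      { unfold seg, circ; rewrite cos_2PI, sin_2PI, cos_0, sin_0; reflexivity. }
      rewrite E; apply (minus_eq_zero (G := R_AbelianGroup)).
Qed.

(** * Continuous complex-valued functions of a real variable and their integrals *)

Definition ccont (f : R -> C) : Prop :=
  forall t, continuity_pt (fun x => Re (f x)) t /\ continuity_pt (fun x => Im (f x)) t.

Lemma continuity_pt_eq (f g : R -> R) t : (forall x, f x = g x) -> continuity_pt f t -> continuity_pt g t.
Proof. intros E; apply continuity_pt_ext; exact E. Qed.

Lemma ccont_const c : ccont (fun _ => c).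
Proof. intros t; split; apply continuity_pt_const; intros x y; reflexivity. Qed.

Lemma ccont_plus f g : ccont f -> ccont g -> ccont (fun t => f t + g t)%C.
Proof.
  intros Hf Hg t; destruct (Hf t), (Hg t); split.
  - apply (continuity_pt_plus (fun x => Re (f x)) (fun x => Re (g x))); assumption.
  - apply (continuity_pt_plus (fun x => Im (f x)) (fun x => Im (g x))); assumption.
Qed.

Lemma ccont_mult f g : ccont f -> ccont g -> ccont (fun t => f t * g t)%C.
Proof.
  intros Hf Hg t; destruct (Hf t), (Hg t); split.
  - apply (continuity_pt_eq (fun x => Re (f x) * Re (g x) - Im (f x) * Im (g x)));
      [intros x; symmetry; apply re_mult|].
    apply (continuity_pt_minus (fun x => Re (f x) * Re (g x)) (fun x => Im (f x) * Im (g x)));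
      [apply (continuity_pt_mult (fun x => Re (f x)) (fun x => Re (g x)))
      |apply (continuity_pt_mult (fun x => Im (f x)) (fun x => Im (g x)))]; assumption.
  - apply (continuity_pt_eq (fun x => Re (f x) * Im (g x) + Im (f x) * Re (g x)));
      [intros x; symmetry; apply im_mult|].
    apply (continuity_pt_plus (fun x => Re (f x) * Im (g x)) (fun x => Im (f x) * Re (g x)));
      [apply (continuity_pt_mult (fun x => Re (f x)) (fun x => Im (g x)))
      |apply (continuity_pt_mult (fun x => Im (f x)) (fun x => Re (g x)))]; assumption.
Qed.

Lemma ccont_pow f n : ccont f -> ccont (fun t => f t ^ n)%C.
Proof.
  intros H; induction n as [|n IH]; [exact (ccont_const (RtoC 1))|].
  exact (ccont_mult _ _ H IH).
Qed.

Lemma ccont_inv f : ccont f -> (forall t, f t <> RtoC 0) -> ccont (fun t => / f t)%C.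
Proof.
  intros H Z t; destruct (H t) as [H1 H2].
  assert (N : Re (f t) * Re (f t) + Im (f t) * Im (f t) <> 0).
  { intros E; apply (Z t); apply Cmod_eq_0.
    assert (Q : Cmod (f t) ^ 2 = 0) by (rewrite Cmod_sqr; lra).
    simpl in Q; rewrite Rmult_1_r in Q; destruct (Rmult_integral _ _ Q); assumption. }
  assert (D : continuity_pt (fun x => Re (f x) * Re (f x) + Im (f x) * Im (f x)) t).
  { apply (continuity_pt_plus (fun x => Re (f x) * Re (f x)) (fun x => Im (f x) * Im (f x)));
      [apply (continuity_pt_mult (fun x => Re (f x)) (fun x => Re (f x)))
      |apply (continuity_pt_mult (fun x => Im (f x)) (fun x => Im (f x)))]; assumption. }
  split.
  - apply (continuity_pt_eq (fun x => Re (f x) / (Re (f x) * Re (f x) + Im (f x) * Im (f x)))).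
    { intros x; unfold Cinv, Re, Im; simpl; rewrite !Rmult_1_r; reflexivity. }
    apply (continuity_pt_div (fun x => Re (f x)) _ t H1 D N).
  - apply (continuity_pt_eq (fun x => - Im (f x) / (Re (f x) * Re (f x) + Im (f x) * Im (f x)))).
    { intros x; unfold Cinv, Re, Im; simpl; rewrite !Rmult_1_r; reflexivity. }
    apply (continuity_pt_div (fun x => - Im (f x)) _ t (continuity_pt_opp _ _ H2) D N).
Qed.

Lemma ccont_cderive g dg : (forall t, is_cderive g t (dg t)) -> ccont g.
Proof.
  intros H t; destruct (H t) as [H1 H2].
  split; apply derivable_continuous_pt, ex_derive_Reals_0; eexists; eassumption.
Qed.

Definition is_cint (f : R -> C) (l : C) : Prop :=
  is_RInt (fun t => Re (f t)) 0 (2 * PI) (Re l) /\ is_RInt (fun t => Im (f t)) 0 (2 * PI) (Im l).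

Definition cint (f : R -> C) : C :=
  (RInt (fun t => Re (f t)) 0 (2 * PI), RInt (fun t => Im (f t)) 0 (2 * PI)).

Lemma ex_RInt_continuity_pt (f : R -> R) a b : (forall t, continuity_pt f t) -> ex_RInt f a b.
Proof.
  intros H; apply (ex_RInt_continuous (V := R_CompleteNormedModule)); intros t _.
  apply continuity_pt_filterlim, H.
Qed.

Lemma is_cint_cint f : ccont f -> is_cint f (cint f).
Proof.
  intros H; split; apply (RInt_correct (V := R_CompleteNormedModule)), ex_RInt_continuity_pt;
    intros t; apply H.
Qed.

Lemma is_cint_unique f l : is_cint f l -> cint f = l.
Proof.
  intros [H1 H2]; unfold cint.
  rewrite (is_RInt_unique _ _ _ _ H1), (is_RInt_unique _ _ _ _ H2); destruct l; reflexivity.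
Qed.

Lemma cint_ext f g : (forall t, f t = g t) -> cint f = cint g.
Proof. intros E; unfold cint; f_equal; apply RInt_ext; intros t _; rewrite E; reflexivity. Qed.

Lemma cint_plus f g : ccont f -> ccont g -> cint (fun t => f t + g t)%C = (cint f + cint g)%C.
Proof.
  intros Hf Hg; destruct (is_cint_cint f Hf), (is_cint_cint g Hg); apply is_cint_unique; split.
  - exact (is_RInt_plusR _ _ _ _ _ _ H H1).
  - exact (is_RInt_plusR _ _ _ _ _ _ H0 H2).
Qed.

Lemma cint_scal k f : ccont f -> cint (fun t => k * f t)%C = (k * cint f)%C.
Proof.
  intros Hf; destruct (is_cint_cint f Hf) as [H1 H2]; apply is_cint_unique; split.
  - apply (is_RInt_ext (fun t => Re k * Re (f t) + (- Im k) * Im (f t))).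
    { intros t _; rewrite re_mult; real_eq; ring. }
    eapply is_RInt_eq; [apply is_RInt_plusR; apply is_RInt_scalR; eassumption|].
    rewrite re_mult; real_eq; ring.
  - apply (is_RInt_ext (fun t => Re k * Im (f t) + Im k * Re (f t))).
    { intros t _; rewrite im_mult; real_eq; ring. }
    eapply is_RInt_eq; [apply is_RInt_plusR; apply is_RInt_scalR; eassumption|].
    rewrite im_mult; real_eq; ring.
Qed.

(** The two parts are bounded separately, which loses a factor 2; the lemma only serves to show that
    remainders tend to zero. *)
Lemma cint_bound f M : ccont f -> (forall t, Cmod (f t) <= M) -> Cmod (cint f) <= 2 * (2 * PI * M).
Proof.
  intros Hf HM; assert (P := PI_RGT_0).
  assert (Q : forall g : R -> R, (forall t, continuity_pt g t) -> (forall t, Rabs (g t) <= M) ->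
     Rabs (RInt g 0 (2 * PI)) <= 2 * PI * M).
  { intros g Hg HgM; eapply Rle_trans; [apply abs_RInt_le_const with (M := M)|].
    - lra.
    - apply ex_RInt_continuity_pt, Hg.
    - intros t _; apply HgM.
    - rewrite Rminus_0_r; lra. }
  apply Cmod_le_parts; apply Q; try (intros t; apply Hf); intros t.
  - eapply Rle_trans; [apply re_le_Cmod|apply HM].
  - eapply Rle_trans; [apply im_le_Cmod|apply HM].
Qed.

(** * The Cauchy kernel and its geometric expansion *)

Definition einv (r t : R) : C := circ (/ r) (- t).

Lemma circ_einv r t : r <> 0 -> (circ r t * einv r t = 1)%C.
Proof.
  intros Hr; unfold circ, einv, circ, Cmult, RtoC; simpl; rewrite cos_neg, sin_neg; f_equal.
  - replace (r * cos t * (/ r * cos t) - r * sin t * (/ r * - sin t))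
      with (r * / r * (Rsqr (sin t) + Rsqr (cos t))) by (unfold Rsqr; ring).
    rewrite sin2_cos2, Rinv_r by auto; ring.
  - field; auto.
Qed.

Lemma ccont_einv r : ccont (einv r).
Proof.
  intros t; split; apply derivable_continuous_pt, ex_derive_Reals_0; unfold einv, circ, Re, Im; simpl;
    auto_derive; exact I.
Qed.

(** This is [zeta / (zeta - w)] for [zeta = circ r t], with [einv r t] standing for [/ zeta]; in
    this form it is the sum of a geometric series. *)
Definition cker (w : C) (r t : R) : C := (/ (1 - w * einv r t))%C.

Lemma Cmod_w_einv w r t : 0 < r -> Cmod (w * einv r t)%C = Cmod w / r.
Proof.
  intros Hr; rewrite Cmod_mult; unfold einv; rewrite Cmod_circ; [reflexivity|].
  left; apply Rinv_0_lt_compat, Hr.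
Qed.

Lemma cker_den w r t : Cmod w < r -> 0 < r -> 1 - Cmod w / r <= Cmod (1 - w * einv r t)%C.
Proof.
  intros Hw Hr; rewrite <- (Cmod_w_einv w r t Hr).
  assert (T := Cmod_triangle (1 - w * einv r t)%C (w * einv r t)%C).
  replace (1 - w * einv r t + w * einv r t)%C with (RtoC 1) in T by ring.
  rewrite Cmod_1 in T; lra.
Qed.

Lemma ratio_lt_1 w r : Cmod w < r -> 0 < r -> 0 <= Cmod w / r < 1.
Proof.
  intros Hw Hr; split; [apply Rdiv_le_0_compat; [apply Cmod_ge_0|auto]|].
  apply Rmult_lt_reg_r with r; [auto|]; unfold Rdiv; rewrite Rmult_assoc, Rinv_l; lra.
Qed.

Lemma cker_den_neq_0 w r t : Cmod w < r -> 0 < r -> (1 - w * einv r t)%C <> RtoC 0.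
Proof.
  intros Hw Hr E; assert (D := cker_den w r t Hw Hr); rewrite E, Cmod_0 in D.
  assert (Q := ratio_lt_1 w r Hw Hr); lra.
Qed.

Lemma cker_eq w r t : Cmod w < r -> 0 < r -> (cker w r t = 1 + cker w r t * (w * einv r t))%C.
Proof.
  intros Hw Hr; unfold cker; field; apply cker_den_neq_0; auto.
Qed.

Lemma cker_circ w r t : Cmod w < r -> 0 < r -> (cker w r t * (circ r t - w) = circ r t)%C.
Proof.
  intros Hw Hr.
  replace (circ r t - w)%C with ((1 - w * einv r t) * circ r t)%C.
  - unfold cker; field; apply cker_den_neq_0; auto.
  - transitivity (circ r t - w * (circ r t * einv r t))%C; [ring|].
    rewrite circ_einv by lra; ring.
Qed.

Lemma ccont_cker w r : Cmod w < r -> 0 < r -> ccont (cker w r).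
Proof.
  intros Hw Hr; apply (ccont_inv (fun t => 1 - w * einv r t)%C).
  - apply (ccont_plus (fun _ => RtoC 1) (fun t => - (w * einv r t))%C); [apply ccont_const|].
    intros t; destruct (ccont_mult (fun _ => w) _ (ccont_const w) (ccont_einv r) t) as [H1 H2].
    split; [exact (continuity_pt_opp _ _ H1)|exact (continuity_pt_opp _ _ H2)].
  - intros t; apply cker_den_neq_0; auto.
Qed.

Lemma Cmod_cker w r t : Cmod w < r -> 0 < r -> Cmod (cker w r t) <= / (1 - Cmod w / r).
Proof.
  intros Hw Hr; unfold cker; rewrite Cmod_inv by (apply cker_den_neq_0; auto).
  assert (Q := ratio_lt_1 w r Hw Hr).
  apply Rinv_le_contravar; [lra|apply cker_den; auto].
Qed.

(** Iterating [cker_eq] expands the kernel to [n] terms with the exact remainder [Rm n], of size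
    [q ^ n]. Only finite sums are thus interchanged with the integral. *)
Lemma cauchy_expansion (f : R -> C) w r : ccont f -> (forall t, Cmod (f t) <= 1) ->
  Cmod w < r -> 0 < r ->
  cv_sum (fun n => cint (fun t => f t * einv r t ^ n)%C * w ^ n)%C (cint (fun t => f t * cker w r t)%C).
Proof.
  intros Hf Hb Hw Hr.
  assert (Q := ratio_lt_1 w r Hw Hr); set (q := Cmod w / r) in *.
  assert (CE := ccont_einv r); assert (CK := ccont_cker w r Hw Hr).
  pose (Rm := fun n t => (f t * cker w r t * (w * einv r t) ^ n)%C).
  assert (CR : forall n, ccont (Rm n)).
  { intros n; apply ccont_mult; [apply ccont_mult; auto|].
    apply ccont_pow, ccont_mult; [apply ccont_const|auto]. }
  assert (E : forall n, cint (fun t => f t * cker w r t)%C =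
    (csum (fun n => cint (fun t => f t * einv r t ^ n) * w ^ n) n + cint (Rm n))%C).
  { induction n as [|n IH].
    - simpl csum; rewrite Cplus_0_l; apply cint_ext; intros t; unfold Rm; simpl; ring.
    - rewrite IH; simpl csum; rewrite <- Cplus_assoc; f_equal.
      rewrite (Cmult_comm _ (w ^ n)).
      rewrite <- (cint_scal (w ^ n)%C (fun t => f t * einv r t ^ n)%C)
        by (apply ccont_mult; [auto|apply ccont_pow, CE]).
      rewrite <- (cint_plus (fun t => w ^ n * (f t * einv r t ^ n))%C (Rm (S n))).
      + apply cint_ext; intros t; unfold Rm; rewrite Cpow_S.
        rewrite (cker_eq w r t Hw Hr) at 1; rewrite !Cpow_mult_l; ring.
      + apply ccont_mult; [apply ccont_const|apply ccont_mult; [auto|apply ccont_pow, CE]].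
      + apply CR. }
  assert (P := PI_RGT_0).
  apply (cv_sum_of_error _ _ (fun n => 4 * PI * / (1 - q) * q ^ n)).
  - intros n; rewrite (E n).
    match goal with |- Cmod (?a - (?a + ?b))%C <= _ => replace (a - (a + b))%C with (- b)%C by ring end.
    rewrite Cmod_opp; eapply Rle_trans; [apply (cint_bound (Rm n) (/ (1 - q) * q ^ n) (CR n))|lra].
    intros t; unfold Rm; rewrite !Cmod_mult, Cmod_pow, Cmod_w_einv by auto; fold q.
    apply Rmult_le_compat_r; [apply pow_le; lra|].
    rewrite <- (Rmult_1_l (/ (1 - q))).
    apply Rmult_le_compat; [apply Cmod_ge_0..|apply Hb|apply Cmod_cker; auto].
  - intros eps He; apply (pow_small q (4 * PI * / (1 - q)) eps Q He).
Qed.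

Lemma cint_einv_pow r n : cint (fun t => 1 * einv r t ^ n)%C = if Nat.eqb n 0 then RtoC (2 * PI) else RtoC 0.
Proof.
  assert (X : forall t, (1 * einv r t ^ n = Cconj (circ (/ r) t ^ n))%C).
  { intros t; rewrite Cmult_1_l; unfold einv; rewrite !circ_pow; unfold Cconj; simpl.
    replace (INR n * - t) with (- (INR n * t)) by ring; rewrite cos_neg, sin_neg; f_equal; ring. }
  rewrite (cint_ext _ _ X); apply is_cint_unique.
  destruct n as [|n]; simpl Nat.eqb; cbv iota.
  - split; [apply (is_RInt_ext (fun _ => 1)); [intros t _; reflexivity|]
           |apply (is_RInt_ext (fun _ => 0)); [intros t _; simpl; real_eq; ring|]];
      (eapply is_RInt_eq; [apply is_RInt_constR|simpl; real_eq; ring]).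
  - split.
    + apply (is_RInt_ext (fun t => Re (1 * Cconj (circ (/ r) t ^ S n))%C)).
      * intros t _; rewrite Cmult_1_l; reflexivity.
      * apply is_RInt_circ_conj_pow; lia.
    + apply (is_RInt_ext (fun t => Re (- Ci * Cconj (circ (/ r) t ^ S n))%C)).
      * intros t _; unfold Re, Im; simpl; real_eq; ring.
      * apply is_RInt_circ_conj_pow; lia.
Qed.

(** The expansion of the constant function 1, in which orthogonality leaves only the term of index
    0; the constant is kept as a factor to match [cauchy_expansion]. *)
Lemma cint_cker w r : Cmod w < r -> 0 < r -> cint (fun t => 1 * cker w r t)%C = RtoC (2 * PI).
Proof.
  intros Hw Hr.
  apply (cv_sum_unique (fun n => if Nat.eqb n 0 then RtoC (2 * PI) else RtoC 0)).
  - generalize (cauchy_expansion (fun _ => RtoC 1) w r (ccont_const 1)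
      ltac:(intros; cbv beta; rewrite Cmod_1; lra) Hw Hr).
    apply cv_sum_ext; intros n; rewrite cint_einv_pow; destruct n; simpl; ring.
  - intros eps He; exists 1%nat; intros [|n] Hn; [lia|].
    rewrite csum_shift, csum_zero by reflexivity; simpl Nat.eqb; cbv iota.
    replace (RtoC (2 * PI) + 0 - RtoC (2 * PI))%C with (RtoC 0) by ring; rewrite Cmod_0; lra.
Qed.

(** The two sides are the values at [s = 1] and [s = 0] of an integral with zero derivative in [s].
    The multiplier [lam], taken to be 1 and then [- Ci], recovers the complex identity from this
    real one. *)
Lemma cauchy_real_part phi dphi lam w r : c1_on_disk phi dphi -> Cmod w < r -> 0 < r < 1 ->
  RInt (fun t => Re (lam * (phi (circ r t) * cker w r t))%C) 0 (2 * PI) =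
  RInt (fun t => Re (lam * (phi w * cker w r t))%C) 0 (2 * PI).
Proof.
  intros HD Hw Hr.
  assert (R0 : 0 < r) by lra.
  pose (f := fun s t => Re ((lam * cker w r t) * phi (seg w r s t))%C).
  assert (D0 : 0 < (1 - r) / 2) by lra.
  assert (Df : forall s0 s t, 0 <= s0 <= 1 -> Rabs (s - s0) < (1 - r) / 2 ->
     is_derive (fun u => f u t) s (Re (lam * dphi (seg w r s t) * circ r t)%C)).
  { intros s0 s t Hs0 Hs.
    assert (D := is_cderive_Re_mult (lam * cker w r t)%C _ _ _
      (is_cderive_comp phi dphi (fun u => seg w r u t) s _ HD
        (seg_in_disk w r s0 s t Hw Hr Hs0 Hs) (seg_derive_s w r s t))).
    cbv beta in D; revert D; match goal with |- is_derive _ _ ?a -> is_derive _ _ ?b =>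
      replace a with b; [intros D; exact D|] end.
    f_equal; transitivity (lam * dphi (seg w r s t) * (cker w r t * (circ r t - w)))%C; [|ring].
    rewrite cker_circ by auto; reflexivity. }
  assert (CF : forall s0 s, 0 <= s0 <= 1 -> Rabs (s - s0) < (1 - r) / 2 ->
     ccont (fun t => (lam * cker w r t) * phi (seg w r s t))%C).
  { intros s0 s Hs0 Hs; apply ccont_mult.
    - apply ccont_mult; [apply ccont_const|apply ccont_cker; auto].
    - apply (ccont_cderive _ (fun t => dphi (seg w r s t) * (RtoC s * Ci * circ r t))%C); intros t.
      apply (is_cderive_comp phi dphi (fun v => seg w r s v) t _ HD
        (seg_in_disk w r s0 s t Hw Hr Hs0 Hs) (seg_derive_t w r s t)). }
  assert (G : forall s, 0 <= s <= 1 -> is_derive (fun s => RInt (fun t => f s t) 0 (2 * PI)) s 0).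
  { intros s Hs.
    assert (Z : RInt (fun t => Derive (fun u => f u t) s) 0 (2 * PI) = 0).
    { apply is_RInt_unique.
      apply (is_RInt_ext (fun t => Re (lam * dphi (seg w r s t) * circ r t)%C)).
      - intros t _; symmetry; apply is_derive_unique, (Df s); auto.
        replace (s - s) with 0 by ring; rewrite Rabs_R0; lra.
      - apply (is_RInt_seg_derivative phi); auto. }
    refine (eq_ind _ (fun l => is_derive (fun s => RInt (fun t => f s t) 0 (2 * PI)) s l) _ _ Z).
    apply is_derive_RInt_param.
    - exists (mkposreal _ D0); intros y Hy t _.
      eexists; apply (Df s); [auto|exact Hy].
    - intros t _; apply (continuity_2d_pt_ext_loc (fun u v => Re (lam * dphi (seg w r u v) * circ r v)%C)).
      + exists (mkposreal _ D0); intros u v Hu Hv; symmetry; apply is_derive_unique, (Df s); auto.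
      + apply (seg_integrand_continuous phi); auto.
        apply (seg_in_disk w r s); auto; replace (s - s) with 0 by ring; rewrite Rabs_R0; lra.
    - exists (mkposreal _ D0); intros y Hy; apply ex_RInt_continuity_pt; intros t.
      apply (CF s y Hs Hy t). }
  assert (E := eq_is_derive (fun s => RInt (fun t => f s t) 0 (2 * PI)) 0 1 G ltac:(lra)).
  cbv beta in E.
  transitivity (RInt (fun t => f 1 t) 0 (2 * PI)); [|rewrite <- E]; apply RInt_ext; intros t _;
    unfold f; f_equal.
  - replace (seg w r 1 t) with (circ r t) by (unfold seg; ring); ring.
  - replace (seg w r 0 t) with w by (unfold seg; ring); ring.
Qed.

Lemma cauchy_formula phi dphi w r : c1_on_disk phi dphi -> Cmod w < r -> 0 < r < 1 ->
  cint (fun t => phi (circ r t) * cker w r t)%C = (RtoC (2 * PI) * phi w)%C.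
Proof.
  intros HD Hw Hr.
  transitivity (cint (fun t => phi w * (1 * cker w r t))%C).
  - assert (R1 := cauchy_real_part phi dphi 1 w r HD Hw Hr).
    assert (R2 := cauchy_real_part phi dphi (- Ci)%C w r HD Hw Hr).
    assert (I : forall z, Re (- Ci * z)%C = Im z) by (intros z; unfold Re, Im; simpl; ring).
    unfold cint; f_equal.
    + revert R1; rewrite (RInt_ext (fun t => Re (1 * (phi (circ r t) * cker w r t))%C)
        (fun t => Re (phi (circ r t) * cker w r t)%C)) by (intros; rewrite Cmult_1_l; reflexivity).
      intros ->; apply RInt_ext; intros t _; f_equal; ring.
    + revert R2; rewrite (RInt_ext (fun t => Re (- Ci * (phi (circ r t) * cker w r t))%C)
        (fun t => Im (phi (circ r t) * cker w r t)%C)) by (intros; apply I).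
      intros ->; apply RInt_ext; intros t _; rewrite I; f_equal; ring.
  - assert (R0 : 0 < r) by lra.
    rewrite cint_scal by (apply ccont_mult; [apply ccont_const|apply ccont_cker; auto]).
    rewrite cint_cker by auto; ring.
Qed.

(** Each circle gives coefficients that might depend on its radius. By uniqueness near the origin
    they all equal those of the local expansion at 0, which therefore converges on the whole
    disk. *)
Lemma taylor_on_disk (phi : C -> C) : analytic_on_disk phi -> (forall z, Cmod z < 1 -> Cmod (phi z) <= 1) ->
  exists c, ps_on 1 c phi.
Proof.
  intros HA HB.
  assert (HD := analytic_c1 phi HA).
  destruct (HA (RtoC 0)) as [r0 [R0 [c Hc]]]; [unfold in_disk; rewrite Cmod_0; lra|].
  assert (P0 : ps_on r0 c phi).
  { intros z Hz; specialize (Hc z).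
    replace (Cminus z 0) with z in Hc by (unfold Cminus; ring).
    specialize (Hc Hz); apply is_series_cv_sum in Hc; revert Hc.
    apply cv_sum_ext; intros n; f_equal; apply cpow_Cpow. }
  exists c; intros w Hw.
  assert (W := Cmod_ge_0 w).
  set (r := (1 + Cmod w) / 2); assert (Hr : 0 < r < 1) by (unfold r; lra).
  assert (Hwr : Cmod w < r) by (unfold r; lra).
  assert (CP : ccont (fun t => phi (circ r t))).
  { apply (ccont_cderive _ (fun t => cderive phi (circ r t) * (RtoC 1 * Ci * circ r t))%C); intros t.
    assert (Q := seg_derive_t 0 r 1 t).
    apply (is_cderive_comp phi (cderive phi) (circ r) t _ HD); [rewrite Cmod_circ; lra|].
    destruct Q as [Q1 Q2]; split.
    - apply (is_derive_ext (fun v => Re (seg 0 r 1 v))); [intros v; f_equal; unfold seg; ring|exact Q1].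
    - apply (is_derive_ext (fun v => Im (seg 0 r 1 v))); [intros v; f_equal; unfold seg; ring|exact Q2]. }
  pose (d := fun n => (/ RtoC (2 * PI) * cint (fun t => phi (circ r t) * einv r t ^ n))%C).
  assert (PI0 : RtoC (2 * PI) <> RtoC 0).
  { intros E; apply RtoC_inj in E; assert (P := PI_RGT_0); lra. }
  assert (Pd : ps_on r d phi).
  { intros z Hz.
    assert (X := cauchy_expansion (fun t => phi (circ r t)) z r CP
      ltac:(intros t; apply HB; rewrite Cmod_circ; lra) Hz ltac:(lra)).
    cbv beta in X; rewrite (cauchy_formula phi (cderive phi) z r HD Hz Hr) in X.
    apply (cv_sum_scal (/ RtoC (2 * PI))%C) in X.
    replace (/ RtoC (2 * PI) * (RtoC (2 * PI) * phi z))%C with (phi z) in X by (field; exact PI0).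
    revert X; apply cv_sum_ext; intros n; unfold d; ring. }
  assert (E := ps_unique r0 r c d phi R0 ltac:(lra) P0 Pd).
  apply (cv_sum_ext (fun n => d n * w ^ n)%C); [intros n; rewrite E; reflexivity|].
  apply Pd, Hwr.
Qed.

(** * Powers and composition of power series *)

Fixpoint powc (c : nat -> C) (m : nat) : nat -> C :=
  match m with
  | O => fun n => match n with O => RtoC 1 | S _ => RtoC 0 end
  | S k => conv c (powc c k)
  end.

(** Stopping at [m = n] loses nothing when [c O] is zero, since [phi^m] then vanishes to order [m]
    at the origin. *)
Definition compc (c a : nat -> C) (n : nat) : C := csum (fun m => a m * powc c m n)%C (S n).

Lemma conv_local_strict c g g' n : c O = RtoC 0 ->
  (forall k, (k < n)%nat -> g k = g' k) -> conv c g n = conv c g' n.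
Proof.
  intros C0 H; apply csum_ext; intros i Hi; unfold sh.
  destruct (Nat.leb_spec i n); [|reflexivity].
  destruct i as [|i]; [rewrite C0; ring|rewrite H by lia; reflexivity].
Qed.

Lemma conv_zero c g n : (forall k, (k <= n)%nat -> g k = RtoC 0) -> conv c g n = RtoC 0.
Proof.
  intros H; apply csum_zero; intros i Hi; unfold sh.
  destruct (Nat.leb_spec i n); [rewrite H by lia|]; ring.
Qed.

Lemma powc_low c m n : c O = RtoC 0 -> (n < m)%nat -> powc c m n = RtoC 0.
Proof.
  intros C0; revert n; induction m as [|m IH]; intros n H; [lia|]; simpl.
  rewrite (conv_local_strict c _ (fun _ => RtoC 0) n C0).
  - apply conv_zero; reflexivity.
  - intros k Hk; apply IH; lia.
Qed.

Lemma comp_extend c a n N : c O = RtoC 0 -> (n < N)%nat ->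
  compc c a n = csum (fun m => a m * powc c m n)%C N.
Proof.
  intros C0 H; unfold compc; symmetry; apply csum_extend; [lia|].
  intros k Hk; rewrite powc_low by (auto; lia); ring.
Qed.

(* [f o phi = f(0) + phi . (B f o phi)], with [B] the backward shift. *)
Lemma comp_backward_shift c a n : c O = RtoC 0 ->
  compc c a n = (a O * powc c O n + conv c (compc c (fun k => a (S k))) n)%C.
Proof.
  intros C0; rewrite (comp_extend c a n (S (S n)) C0) by lia.
  rewrite csum_shift; f_equal; unfold conv.
  rewrite (csum_ext (fun i => c i * sh i (compc c (fun k => a (S k))) n)%C
    (fun i => csum (fun m => a (S m) * (c i * sh i (powc c m) n))%C (S n))).
  - rewrite csum_swap; apply csum_ext; intros m Hm; rewrite csum_scal; reflexivity.
  - intros i Hi; unfold sh; destruct (Nat.leb_spec i n); [|lia].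
    rewrite (comp_extend c _ (n - i) (S n) C0) by lia.
    rewrite <- csum_scal; apply csum_ext; intros; ring.
Qed.

Lemma conv_at_0 c g : c O = RtoC 0 -> conv c g O = RtoC 0.
Proof. intros C0; unfold conv; simpl; rewrite C0; ring. Qed.

(* Littlewood's subordination principle for truncated sums. *)
Lemma comp_contractive c phi : ps_on 1 c phi -> (forall z, Cmod z < 1 -> Cmod (phi z) <= 1) ->
  c O = RtoC 0 -> forall N a,
  rsum (fun n => Cmod (compc c a n) ^ 2) N <= rsum (fun n => Cmod (a n) ^ 2) N.
Proof.
  intros H B C0; induction N as [|N IH]; intros a; [simpl; lra|].
  rewrite !rsum_shift.
  set (g := compc c (fun k => a (S k))).
  assert (E0 : compc c a O = a O).
  { rewrite comp_backward_shift, conv_at_0 by auto; simpl; ring. }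
  rewrite E0; apply Rplus_le_compat_l.
  apply Rle_trans with (rsum (fun n => Cmod (g n) ^ 2) N); [|apply IH].
  (* [g] is cut at [N] because [conv_contractive] compares sums of equal length [S N]: on the left
     the term of index 0 vanishes with [c O], on the right the cut kills the term of index [N]. *)
  rewrite (rsum_ext _ (fun n => Cmod (conv c (trunc N g) (S n)) ^ 2)).
  - assert (Q := conv_contractive c phi (trunc N g) (S N) H B).
    rewrite rsum_shift, conv_at_0, Cmod_0 in Q by auto.
    rewrite (rsum_ext (fun n => Cmod (g n) ^ 2) (fun n => Cmod (trunc N g n) ^ 2)).
    + assert (QE : rsum (fun n => Cmod (trunc N g n) ^ 2) (S N) =
        rsum (fun n => Cmod (trunc N g n) ^ 2) N)
        by (simpl; rewrite trunc_ge, Cmod_0 by auto; ring).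
      rewrite QE in Q; lra.
    + intros k Hk; rewrite trunc_lt by auto; reflexivity.
  - intros n Hn; do 2 f_equal; rewrite comp_backward_shift by auto.
    simpl powc; rewrite (conv_local_strict c (trunc N g) g (S n) C0); [unfold g; ring|].
    intros k Hk; apply trunc_lt; lia.
Qed.

(** Multiplication by [phi] is applied [m] times to the constant 1. *)
Lemma powc_l2 c phi m N : ps_on 1 c phi -> (forall z, Cmod z < 1 -> Cmod (phi z) <= 1) ->
  rsum (fun n => Cmod (powc c m n) ^ 2) N <= 1.
Proof.
  intros H B; induction m as [|m IH].
  - destruct N as [|N]; [simpl; lra|]; rewrite rsum_shift; simpl powc; rewrite Cmod_1, Cmod_0.
    rewrite (rsum_ext _ (fun _ => 0)) by (intros; ring). rewrite rsum_const; lra.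
  - eapply Rle_trans; [apply (conv_contractive c phi (powc c m) N H B)|exact IH].
Qed.

Lemma rsum_term_le f n N : (n < N)%nat -> (forall k, 0 <= f k) -> f n <= rsum f N.
Proof.
  intros H P; apply Rle_trans with (rsum f (S n)); [|apply rsum_mono; auto].
  simpl; assert (0 <= rsum f n) by (apply rsum_nonneg, P); lra.
Qed.

Lemma powc_le_1 c phi m n : ps_on 1 c phi -> (forall z, Cmod z < 1 -> Cmod (phi z) <= 1) ->
  Cmod (powc c m n) <= 1.
Proof.
  intros H B; assert (P := powc_l2 c phi m (S n) H B).
  assert (Q := rsum_term_le (fun n => Cmod (powc c m n) ^ 2) n (S n) ltac:(lia)
    (fun k => pow2_ge_0 _)). simpl in Q, P.
  assert (G := Cmod_ge_0 (powc c m n)). nra.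
Qed.

Lemma powc_1 c n : powc c 1 n = c n.
Proof.
  simpl; unfold conv; simpl csum; rewrite csum_zero.
  - unfold sh; rewrite Nat.leb_refl, Nat.sub_diag; ring.
  - intros k Hk; unfold sh; destruct (Nat.leb_spec k n); [|lia].
    replace (n - k)%nat with (S (n - k - 1)) by lia; ring.
Qed.

(** Counting from the leading order [S m] of the product, only [d + 1] terms survive; the cases
    [d = 0] and [d = 1] give the diagonal and the first subdiagonal of the matrix. *)
Lemma conv_low c g m d : c O = RtoC 0 -> (forall k, (k < m)%nat -> g k = RtoC 0) ->
  conv c g (S (m + d)) = csum (fun j => c (S j) * g (m + d - j)%nat)%C (S d).
Proof.
  intros C0 G; unfold conv; rewrite csum_shift, C0, Cmult_0_l, Cplus_0_l.
  rewrite (csum_extend _ (S d)).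
  - apply csum_ext; intros j Hj; unfold sh.
    destruct (Nat.leb_spec (S j) (S (m + d))); [|lia]; reflexivity.
  - lia.
  - intros k Hk; unfold sh; destruct (Nat.leb_spec (S k) (S (m + d))); [|ring].
    rewrite G by lia; ring.
Qed.

Lemma powc_diag c m : c O = RtoC 0 -> powc c m m = (c 1%nat ^ m)%C.
Proof.
  intros C0; induction m as [|m IH]; [reflexivity|].
  simpl powc; assert (E := conv_low c (powc c m) m 0 C0 (fun k Hk => powc_low c m k C0 Hk)).
  rewrite Nat.add_0_r in E; rewrite E; simpl; rewrite Nat.sub_0_r, IH; ring.
Qed.

(** One of the [S m] factors [phi] contributes its coefficient of index 2, all the others theirs of
    index 1. *)
Lemma powc_subdiag_bound c m : c O = RtoC 0 ->
  Cmod (powc c (S m) (S (S m))) <= INR (S m) * (Cmod (c 1%nat) ^ m * Cmod (c 2%nat)).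
Proof.
  intros C0; induction m as [|m IH].
  - rewrite powc_1; simpl; lra.
  - change (powc c (S (S m))) with (conv c (powc c (S m))).
    assert (E := conv_low c (powc c (S m)) (S m) 1 C0 (fun k Hk => powc_low c (S m) k C0 Hk)).
    assert (D := powc_diag c (S m) C0).
    set (g := powc c (S m)) in *.
    replace (S (S m + 1)) with (S (S (S m))) in E by lia; rewrite E.
    assert (E2 : csum (fun j => c (S j) * g (S m + 1 - j)%nat)%C 2 =
      (c 1%nat * g (S (S m)) + c 2%nat * g (S m))%C).
    { unfold csum; replace (S m + 1 - 0)%nat with (S (S m)) by lia.
      replace (S m + 1 - 1)%nat with (S m) by lia; ring. }
    rewrite E2; eapply Rle_trans; [apply Cmod_triangle|].
    rewrite !Cmod_mult, D, Cmod_pow.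
    rewrite (S_INR (S m)).
    apply Rmult_le_compat_l with (r := Cmod (c 1%nat)) in IH; [|apply Cmod_ge_0].
    simpl pow in *; lra.
Qed.

Lemma subdiag_decay c phi : ps_on 1 c phi -> (forall z, Cmod z < 1 -> Cmod (phi z) <= 1) ->
  c O = RtoC 0 -> exists K, 0 <= K /\
  forall m, (1 <= m)%nat -> INR (S m) * Cmod (powc c m (S m)) ^ 2 <= K.
Proof.
  intros H B C0.
  (* The first three coefficients of [phi] give [|c_1|^2 + |c_2|^2 <= 1], so [|c_1| < 1] unless
     [c_2 = 0]. *)
  assert (S3 := powc_l2 c phi 1 3 H B).
  rewrite (rsum_ext _ (fun n => Cmod (c n) ^ 2)) in S3 by (intros; rewrite powc_1; reflexivity).
  simpl rsum in S3; rewrite C0, Cmod_0 in S3.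
  assert (G1 := Cmod_ge_0 (c 1%nat)); assert (G2 := Cmod_ge_0 (c 2%nat)).
  assert (Q : exists K, 0 <= K /\
    forall m, INR (S (S m)) * (INR (S m) * (Cmod (c 1%nat) ^ m * Cmod (c 2%nat))) ^ 2 <= K).
  { destruct (Req_dec (Cmod (c 2%nat)) 0) as [Z|Z].
    { exists 0; split; [lra|]; intros m; rewrite Z; right; ring. }
    assert (L1 : Cmod (c 1%nat) < 1) by nra.
    assert (L2 : Cmod (c 2%nat) <= 1) by nra.
    set (x := Cmod (c 1%nat)) in *; set (y := Cmod (c 2%nat)) in *.
    (* Exponent 3: two powers of the index come from the squared entry, one from the factor in
       front. The 12 is a generous constant in [T]. *)
    destruct (natpow_mul_pow_bounded 3 (x ^ 2)) as [K3 [P3 H3]]; [nra|].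
    exists (12 * (K3 + 1)); split; [lra|]; intros m; specialize (H3 m).
    rewrite <- pow_mult, Nat.mul_comm, pow_mult in H3.
    assert (X : 0 <= x ^ m <= 1).
    { split; [apply pow_le; lra|]. eapply Rle_trans; [apply (pow_incr x 1); lra|rewrite pow1; lra]. }
    assert (Y : y ^ 2 <= 1) by nra. assert (Y0 : 0 <= y ^ 2) by apply pow2_ge_0.
    assert (M := pos_INR m).
    assert (W : 0 <= (x ^ m) ^ 2 <= 1) by (split; [apply pow2_ge_0|nra]).
    rewrite !S_INR.
    assert (T : (INR m + 1 + 1) * (INR m + 1) ^ 2 <= 12 * (INR m ^ 3 + 1)).
    { assert (0 <= INR m * (INR m - 1) ^ 2) by (apply Rmult_le_pos; [auto|apply pow2_ge_0]). nra. }
    replace ((INR m + 1 + 1) * ((INR m + 1) * (x ^ m * y)) ^ 2)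
      with ((INR m + 1 + 1) * (INR m + 1) ^ 2 * (x ^ m) ^ 2 * y ^ 2) by ring.
    assert (T2 : (INR m + 1 + 1) * (INR m + 1) ^ 2 * (x ^ m) ^ 2 <= 12 * (K3 + 1)).
    { apply Rmult_le_compat_r with (r := (x ^ m) ^ 2) in T; [|lra]. nra. }
    assert (T3 : 0 <= (INR m + 1 + 1) * (INR m + 1) ^ 2 * (x ^ m) ^ 2).
    { repeat apply Rmult_le_pos; try lra; try apply pow2_ge_0; lra. }
    nra. }
  destruct Q as [K [K0 HK]]; exists K; split; [exact K0|].
  intros [|m] Hm; [lia|]; eapply Rle_trans; [|apply HK].
  apply Rmult_le_compat_l; [apply pos_INR|].
  apply pow_incr; split; [apply Cmod_ge_0|apply powc_subdiag_bound, C0].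
Qed.

(** The error of a Cauchy product splits into the error of [phi] times [phi^m], and a sum pairing
    the term [i] of [phi] with the tail of [phi^m] from [n - i]. Each of the [n] pairs is at most
    [q^i q^(n-i) / (1 - q)], for a total of order [n q^n]. *)
Lemma ps_powc c phi m : ps_on 1 c phi -> (forall z, Cmod z < 1 -> Cmod (phi z) <= 1) ->
  ps_on 1 (powc c m) (fun z => (phi z ^ m)%C).
Proof.
  intros H B; induction m as [|m IH]; intros z Hz.
  - intros eps He; exists 1%nat; intros [|n] Hn; [lia|].
    rewrite csum_shift, csum_zero by (intros; simpl; ring).
    replace (powc c 0 0 * z ^ 0 + 0 - phi z ^ 0)%C with (RtoC 0) by (simpl; ring).
    rewrite Cmod_0; lra.
  - assert (Q : 0 <= Cmod z < 1) by (split; [apply Cmod_ge_0|auto]).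
    set (q := Cmod z) in *; set (g := powc c m); set (G := (phi z ^ m)%C).
    assert (GB : forall n, Cmod (g n * z ^ n)%C <= 1 * q ^ n).
    { intros n; rewrite Cmod_mult, Cmod_pow; apply Rmult_le_compat_r; [apply pow_le; lra|].
      apply (powc_le_1 c phi); auto. }
    assert (CB : forall n, Cmod (c n * z ^ n)%C <= q ^ n).
    { intros n; rewrite <- powc_1, Cmod_mult, Cmod_pow, <- (Rmult_1_l (q ^ n)).
      apply Rmult_le_compat_r; [apply pow_le; lra|]. apply (powc_le_1 c phi); auto. }
    assert (G1 : Cmod G <= 1).
    { unfold G; rewrite Cmod_pow.
      eapply Rle_trans; [apply (pow_incr _ 1); split; [apply Cmod_ge_0|apply B, Hz]|].
      rewrite pow1; lra. }
    assert (T : forall n, Cmod (G - pe g z n)%C <= 1 * q ^ n / (1 - q)).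
    { intros n; apply (cv_sum_tail_bound _ _ 1 q n (IH z Hz)); auto; lra. }
    intros eps He.
    destruct (H z Hz (eps / 2)) as [N1 HN1]; [lra|].
    destruct (nat_geom_small q (/ (1 - q)) Q (eps / 2)) as [N2 HN2]; [lra|].
    exists (N1 + N2)%nat; intros n Hn.
    specialize (HN1 n ltac:(lia)); specialize (HN2 n ltac:(lia)).
    change (csum (fun k => powc c (S m) k * z ^ k)%C n) with (pe (conv c g) z n).
    rewrite pe_conv.
    replace (csum (fun i => c i * z ^ i * pe g z (n - i))%C n - phi z ^ S m)%C
      with ((csum (fun k => c k * z ^ k)%C n - phi z) * G +
            csum (fun i => - (c i * z ^ i) * (G - pe g z (n - i)))%C n)%C.
    + eapply Rle_lt_trans; [apply Cmod_triangle|].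
      assert (A1 : Cmod ((csum (fun k => c k * z ^ k) n - phi z) * G)%C <= eps / 2).
      { rewrite Cmod_mult. assert (G2 := Cmod_ge_0 G).
        assert (G3 := Cmod_ge_0 (csum (fun k => c k * z ^ k) n - phi z)%C). nra. }
      assert (A2 : Cmod (csum (fun i => - (c i * z ^ i) * (G - pe g z (n - i)))%C n)
                   <= / (1 - q) * INR n * q ^ n); [|lra].
      eapply Rle_trans; [apply Cmod_csum_le|].
      eapply Rle_trans; [apply (rsum_le _ (fun _ => / (1 - q) * q ^ n))|rewrite rsum_const; lra].
      intros i Hi; rewrite Cmod_mult, Cmod_opp.
      eapply Rle_trans; [apply Rmult_le_compat; [apply Cmod_ge_0..|apply CB|apply T]|].
      replace n with (i + (n - i))%nat at 2 by lia; rewrite pow_add; unfold Rdiv; lra.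
    + transitivity (csum (fun k => c k * z ^ k)%C n * G - phi z ^ S m +
            csum (fun i => - (c i * z ^ i) * (G - pe g z (n - i)))%C n)%C;
        [unfold G; rewrite Cpow_S; ring|].
      transitivity ((G * csum (fun k => c k * z ^ k)%C n +
            csum (fun i => - (c i * z ^ i) * (G - pe g z (n - i)))%C n) - phi z ^ S m)%C; [ring|].
      f_equal; rewrite <- csum_scal, <- csum_plus; apply csum_ext; intros; ring.
Qed.

(** The coefficients [a m] may be unbounded, but those with [m < n] are at most [K / rho^n] for a
    radius [rho] between [|z|] and 1. The tail of [phi^m] beyond [n] is of order [|z|^n] uniformly
    in [m], so the rearrangement error is of order [n (|z| / rho)^n]. *)
Lemma comp_value c phi a z w : ps_on 1 c phi -> (forall z, Cmod z < 1 -> Cmod (phi z) <= 1) ->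
  c O = RtoC 0 ->
  (forall z, Cmod z < 1 -> exists l, cv_sum (fun n => a n * z ^ n)%C l) ->
  Cmod z < 1 -> cv_sum (fun n => a n * phi z ^ n)%C w ->
  cv_sum (fun n => compc c a n * z ^ n)%C w.
Proof.
  intros H B C0 HA Hz HW.
  assert (G0 := Cmod_ge_0 z).
  set (q := Cmod z) in *; set (rho := (1 + q) / 2).
  destruct (HA (RtoC rho)) as [l Hl]; [unfold rho; rewrite Cmod_R, Rabs_pos_eq; lra|].
  destruct (cv_sum_bounded _ _ Hl) as [K [K0 HK]].
  assert (R0 : 0 < rho < 1) by (unfold rho; lra).
  assert (AB : forall n m, (m < n)%nat -> Cmod (a m) <= K * / rho ^ n).
  { intros n m Hm; specialize (HK m).
    rewrite Cmod_mult, Cmod_pow, Cmod_R, Rabs_pos_eq in HK by lra.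
    assert (P1 : 0 < rho ^ m) by (apply pow_lt; lra).
    assert (P2 : 0 < rho ^ n) by (apply pow_lt; lra).
    assert (P3 : rho ^ n <= rho ^ m).
    { replace n with (m + (n - m))%nat by lia; rewrite pow_add.
      assert (rho ^ (n - m) <= 1).
      { eapply Rle_trans; [apply (pow_incr _ 1); lra|rewrite pow1; lra]. }
      nra. }
    apply Rmult_le_reg_r with (rho ^ n); [exact P2|].
    rewrite Rmult_assoc, Rinv_l by lra. assert (Q := Cmod_ge_0 (a m)). nra. }
  set (t := q / rho).
  assert (Ht : 0 <= t < 1).
  { unfold t; split; [apply Rdiv_le_0_compat; lra|].
    apply Rmult_lt_reg_r with rho; [lra|].
    unfold Rdiv; rewrite Rmult_assoc, Rinv_l by lra; unfold rho; lra. }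
  intros eps He.
  destruct (HW (eps / 2)) as [N1 HN1]; [lra|].
  destruct (nat_geom_small t (K / (1 - q)) Ht (eps / 2)) as [N2 HN2]; [lra|].
  exists (N1 + N2)%nat; intros n Hn.
  specialize (HN1 n ltac:(lia)); specialize (HN2 n ltac:(lia)).
  assert (E : csum (fun k => compc c a k * z ^ k)%C n =
     csum (fun m => a m * pe (powc c m) z n)%C n).
  { rewrite (csum_ext _ (fun k => csum (fun m => a m * (powc c m k * z ^ k))%C n)).
    - rewrite csum_swap; apply csum_ext; intros m Hm; apply csum_scal.
    - intros k Hk; rewrite (comp_extend c a k n C0 Hk).
      transitivity (z ^ k * csum (fun m => a m * powc c m k) n)%C; [ring|].
      rewrite <- csum_scal; apply csum_ext; intros; ring. }
  rewrite E.
  replace (csum (fun m => a m * pe (powc c m) z n)%C n - w)%C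
    with ((csum (fun m => a m * phi z ^ m)%C n - w) +
          csum (fun m => - a m * (phi z ^ m - pe (powc c m) z n))%C n)%C.
  - eapply Rle_lt_trans; [apply Cmod_triangle|].
    assert (A2 : Cmod (csum (fun m => - a m * (phi z ^ m - pe (powc c m) z n))%C n)
       <= K / (1 - q) * INR n * t ^ n); [|lra].
    eapply Rle_trans; [apply Cmod_csum_le|].
    eapply Rle_trans; [apply (rsum_le _ (fun _ => K / (1 - q) * t ^ n))|rewrite rsum_const; lra].
    intros m Hm; rewrite Cmod_mult, Cmod_opp.
    assert (T : Cmod (phi z ^ m - pe (powc c m) z n)%C <= 1 * q ^ n / (1 - q)).
    { apply (cv_sum_tail_bound _ _ 1 q n (ps_powc c phi m H B z Hz)); try lra.
      intros k _; rewrite Cmod_mult, Cmod_pow; apply Rmult_le_compat_r; [apply pow_le; auto|].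
      apply (powc_le_1 c phi); auto. }
    eapply Rle_trans; [apply Rmult_le_compat; [apply Cmod_ge_0..|apply (AB n m Hm)|apply T]|].
    unfold t, Rdiv; rewrite Rpow_mult_distr, pow_inv; right; ring.
  - transitivity ((csum (fun m => a m * phi z ^ m)%C n +
          csum (fun m => - a m * (phi z ^ m - pe (powc c m) z n))%C n) - w)%C; [ring|].
    f_equal; rewrite <- csum_plus; apply csum_ext; intros; ring.
Qed.

(** * The weight *)

Lemma sum_n_rsum (f : nat -> R) n : sum_n f n = rsum f (S n).
Proof.
  induction n as [|n IH].
  - rewrite sum_O; simpl; real_eq; ring.
  - rewrite sum_Sn, IH; reflexivity.
Qed.

Lemma series_of_bounded (f : nat -> R) B : (forall n, 0 <= f n) ->
  (forall N, rsum f N <= B) -> ex_series f /\ Series f <= B.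
Proof.
  intros P H.
  assert (I : forall n, sum_n f n <= sum_n f (S n)).
  { intros n; rewrite !sum_n_rsum; simpl; specialize (P (S n)); lra. }
  destruct (ex_finite_lim_seq_incr (sum_n f) B I) as [l Hl].
  { intros n; rewrite sum_n_rsum; apply H. }
  split; [exists l; exact Hl|].
  rewrite (is_series_unique f l Hl).
  apply (is_lim_seq_le (sum_n f) (fun _ => B) l B); [|exact Hl|apply is_lim_seq_const].
  intros n; rewrite sum_n_rsum; apply H.
Qed.

Lemma rsum_le_Series (f : nat -> R) N : (forall n, 0 <= f n) -> ex_series f ->
  rsum f N <= Series f.
Proof.
  intros P H.
  apply Rle_trans with (sum_n f N); [rewrite sum_n_rsum; apply rsum_mono; auto|].
  apply (is_lim_seq_incr_compare (sum_n f)); [apply Series_correct, H|].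
  intros n; rewrite !sum_n_rsum; simpl; specialize (P (S n)); lra.
Qed.

Lemma abel_le (d u v : nat -> R) N : (forall n, 0 <= d (S n) <= d n) ->
  (forall n, rsum v n <= rsum u n) ->
  rsum (fun n => d n * v n) N <= rsum (fun n => d n * u n) N.
Proof.
  intros D H.
  (* The boundary term of the summation by parts is kept so that the induction closes; it is
     nonnegative. *)
  assert (Q : d N * (rsum u N - rsum v N) <=
    rsum (fun n => d n * u n) N - rsum (fun n => d n * v n) N).
  { induction N as [|N IH]; simpl; [lra|].
    specialize (H (S N)); specialize (D N); simpl in H. nra. }
  assert (0 <= d N) by (specialize (D N); lra).
  specialize (H N); nra.
Qed.

Lemma abel_summation (h u : nat -> R) N :
  rsum (fun n => (h n - h (S n)) * rsum u (S n)) N + h N * rsum u N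
    = rsum (fun n => h n * u n) N.
Proof.
  induction N as [|N IH]; [simpl; ring|].
  transitivity (rsum (fun n => h n * u n) N + h N * u N); [|reflexivity].
  rewrite <- IH; simpl; ring.
Qed.

(** Here [u] and [v] are the squared moduli of the coefficients before and after composition. The
    constant 7 is 1 for the minorant [d], 4 for the Abel sum (a factor 2 in the spike estimate times
    2 for height against drop) and 2 for the coefficient at the spike itself; [2 * K] pays for the
    dip before it. *)
Lemma weighted_bound (beta d u v : nat -> R) (spike : nat -> bool) K B :
  (forall n, 0 <= d (S n) <= d n) -> (forall n, d n <= beta n) ->
  (forall n, spike n = false -> beta n = d n) ->
  spike O = false -> spike 1%nat = false ->
  (forall n, 0 <= u n) -> (forall n, 0 <= v n) -> 0 <= K ->
  (forall n, spike (S (S n)) = true -> beta (S (S n)) <= 2 * (d n - d (S n))) ->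
  (forall n, rsum v n <= rsum u n) ->
  (forall n, spike (S (S n)) = true ->
     beta (S (S n)) * v (S (S n)) <=
       2 * beta (S (S n)) * (rsum u (S n) + u (S (S n))) + 2 * K * (beta (S n) * u (S n))) ->
  (forall N, rsum (fun n => beta n * u n) N <= B) ->
  forall N, rsum (fun n => beta n * v n) N <= (7 + 2 * K) * B.
Proof.
  intros D DB NS S0 S1 U V HK SP L E HB N.
  assert (DP : forall n, 0 <= d n) by (intros n; specialize (D n); lra).
  assert (BP : forall n, 0 <= beta n) by (intros n; specialize (DP n); specialize (DB n); lra).
  pose (sp := fun n => if spike n then beta n * v n else 0).
  assert (SP0 : forall n, 0 <= sp n).
  { intros n; unfold sp; destruct (spike n); [apply Rmult_le_pos; auto|lra]. }
  assert (DU : rsum (fun n => d n * u n) N <= B).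
  { eapply Rle_trans; [|apply (HB N)]; apply rsum_le; intros; apply Rmult_le_compat_r; auto. }
  assert (I1 : rsum (fun n => beta n * v n) N <= B + rsum sp N).
  { apply Rle_trans with (rsum (fun n => d n * v n + sp n) N).
    - apply rsum_le; intros n _; unfold sp; destruct (spike n) eqn:Sn.
      + assert (0 <= d n * v n) by (apply Rmult_le_pos; auto); lra.
      + rewrite NS by auto; lra.
    - rewrite rsum_plus; apply Rplus_le_compat_r.
      eapply Rle_trans; [apply (abel_le d u v N D L)|exact DU]. }
  assert (I2 : rsum sp N <= rsum (fun n => sp (S (S n))) N).
  { apply Rle_trans with (rsum sp (S (S N))); [apply rsum_mono; auto|].
    rewrite !rsum_shift; unfold sp at 1 2; rewrite S0, S1; lra. }
  assert (I3 : rsum (fun n => sp (S (S n))) N <=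
    rsum (fun n => 4 * ((d n - d (S n)) * rsum u (S n)) +
      (2 * (beta (S (S n)) * u (S (S n))) + 2 * K * (beta (S n) * u (S n)))) N).
  { apply rsum_le; intros n _; unfold sp; destruct (spike (S (S n))) eqn:Sn.
    - eapply Rle_trans; [apply E, Sn|]. specialize (SP n Sn).
      assert (0 <= rsum u (S n)) by (apply rsum_nonneg, U). nra.
    - assert (0 <= rsum u (S n)) by (apply rsum_nonneg, U).
      assert (0 <= (d n - d (S n)) * rsum u (S n))
        by (apply Rmult_le_pos; [specialize (D n); lra|auto]).
      assert (0 <= beta (S (S n)) * u (S (S n))) by (apply Rmult_le_pos; auto).
      assert (0 <= beta (S n) * u (S n)) by (apply Rmult_le_pos; auto).
      assert (0 <= K * (beta (S n) * u (S n))) by (apply Rmult_le_pos; auto).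
      lra. }
  rewrite !rsum_plus, !rsum_scal in I3.
  assert (A := abel_summation d u N).
  assert (A0 : 0 <= d N * rsum u N) by (apply Rmult_le_pos; [auto|apply rsum_nonneg, U]).
  assert (B1 := HB (S N)); assert (B2 := HB (S (S N))).
  rewrite rsum_shift in B1; rewrite !rsum_shift in B2.
  assert (P0 : 0 <= beta O * u O) by (apply Rmult_le_pos; auto).
  assert (P1 : 0 <= beta 1%nat * u 1%nat) by (apply Rmult_le_pos; auto).
  nra.
Qed.

(* The largest [k >= 1] with [k! <= n], and [1] for [n = 0]. *)
Fixpoint rk (n : nat) : nat :=
  match n with
  | O => 1%nat
  | S k => if Nat.leb (fact (S (rk k))) (S k) then S (rk k) else rk k
  end.

Lemma rk_S n : rk (S n) = if Nat.leb (fact (S (rk n))) (S n) then S (rk n) else rk n.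
Proof. reflexivity. Qed.

Lemma rk_bounds n : (1 <= rk n)%nat /\ (n < fact (S (rk n)))%nat /\ (1 <= n -> fact (rk n) <= n)%nat.
Proof.
  induction n as [|n [I1 [I2 I3]]]; [simpl; lia|].
  rewrite rk_S; destruct (Nat.leb_spec (fact (S (rk n))) (S n)) as [H|H].
  - split; [lia|split; [|intros _; exact H]].
    change (fact (S (S (rk n)))) with (S (S (rk n)) * fact (S (rk n)))%nat.
    assert (F := lt_O_fact (S (rk n))). nia.
  - split; [lia|split; [exact H|intros _]].
    destruct n as [|n]; [simpl; lia|specialize (I3 ltac:(lia)); lia].
Qed.

Lemma rk_unique n k : (1 <= k)%nat -> (fact k <= n)%nat -> (n < fact (S k))%nat -> rk n = k.
Proof.
  intros K1 H1 H2; destruct (rk_bounds n) as [B1 [B2 B3]].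
  assert (F := lt_O_fact k); specialize (B3 ltac:(lia)).
  destruct (lt_eq_lt_dec (rk n) k) as [[L|E]|L]; [|exact E|].
  - assert (G := fact_le (S (rk n)) k ltac:(lia)); lia.
  - assert (G := fact_le (S k) (rk n) ltac:(lia)); lia.
Qed.

Lemma fact_double k : (1 <= k)%nat -> (2 * fact k <= fact (S k))%nat.
Proof.
  intros H; change (fact (S k)) with (S k * fact k)%nat; apply Nat.mul_le_mono_r; lia.
Qed.

Definition dec (n : nat) : R := / INR (fact (rk n)).

(** The first spike is at 3: the index [1! + 1 = 2] is itself [2!] and has rank 2. *)
Definition spike (n : nat) : bool := Nat.eqb n (S (fact (rk n))).

Definition beta0 (n : nat) : R := if spike n then / INR (fact (rk n - 1)) else dec n.

Lemma INR_fact_pos k : 0 < INR (fact k).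
Proof. apply lt_0_INR, lt_O_fact. Qed.

Lemma inv_fact_le j k : (j <= k)%nat -> / INR (fact k) <= / INR (fact j).
Proof.
  intros H; apply Rinv_le_contravar; [apply INR_fact_pos|].
  apply le_INR, fact_le, H.
Qed.

Lemma dec_pos n : 0 < dec n.
Proof. apply Rinv_0_lt_compat, INR_fact_pos. Qed.

Lemma dec_decr n : 0 <= dec (S n) <= dec n.
Proof.
  split; [left; apply dec_pos|]; unfold dec; apply inv_fact_le; rewrite rk_S.
  destruct (Nat.leb (fact (S (rk n))) (S n)); lia.
Qed.

Lemma dec_le_beta0 n : dec n <= beta0 n.
Proof. unfold beta0; destruct (spike n); [apply inv_fact_le; lia|lra]. Qed.

Lemma beta0_pos n : 0 < beta0 n.
Proof. apply Rlt_le_trans with (dec n); [apply dec_pos|apply dec_le_beta0]. Qed.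

Lemma beta0_le_1 n : beta0 n <= 1.
Proof.
  assert (Q : forall k, / INR (fact k) <= 1).
  { intros k; replace 1 with (/ INR (fact 0)) by (simpl; lra). apply inv_fact_le; lia. }
  unfold beta0, dec; destruct (spike n); apply Q.
Qed.

Lemma spike_true n : spike n = true ->
  exists k, (2 <= k)%nat /\ n = S (fact k) /\ rk n = k.
Proof.
  intros H; apply Nat.eqb_eq in H; exists (rk n); split; [|auto].
  destruct (rk_bounds n) as [B1 _].
  destruct (Nat.eq_dec (rk n) 1) as [E|E]; [|lia].
  rewrite E in H; simpl in H; subst n; discriminate E.
Qed.

Lemma rk_fact k : (1 <= k)%nat -> rk (fact k) = k.
Proof.
  intros H; apply rk_unique; auto; assert (F := lt_O_fact k); assert (G := fact_double k H); lia.
Qed.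

Lemma rk_S_fact k : (2 <= k)%nat -> rk (S (fact k)) = k.
Proof.
  intros H; apply rk_unique; [lia|lia|].
  assert (G := fact_double k ltac:(lia)); assert (F := fact_le 2 k H); simpl in F; lia.
Qed.

Lemma rk_pred_fact k : (2 <= k)%nat -> rk (fact k - 1) = (k - 1)%nat.
Proof.
  intros H; destruct k as [|k]; [lia|].
  assert (G := fact_double k ltac:(lia)); assert (F := lt_O_fact k).
  replace (S k - 1)%nat with k by lia; apply rk_unique; lia.
Qed.

(** Here [n = k! - 1] ends the previous block and [S n = k!] is the dip. The drop between them is
    [1 - 1 / k >= 1 / 2] of the spike height, and the spike-to-dip ratio [k] is crudely replaced by
    the index, the form in which [subdiag_decay] absorbs it. *)
Lemma spike_SS n : spike (S (S n)) = true ->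
  beta0 (S (S n)) <= 2 * (dec n - dec (S n)) /\ beta0 (S (S n)) <= INR (S (S n)) * dec (S n).
Proof.
  intros H; destruct (spike_true _ H) as [k [K2 [E R]]].
  assert (E1 : S n = fact k) by lia.
  assert (E2 : n = (fact k - 1)%nat) by lia.
  assert (D1 : dec (S n) = / INR (fact k)) by (unfold dec; rewrite E1, rk_fact by lia; reflexivity).
  assert (D2 : dec n = / INR (fact (k - 1))) by (unfold dec; rewrite E2, rk_pred_fact by lia; reflexivity).
  assert (D3 : beta0 (S (S n)) = / INR (fact (k - 1))) by (unfold beta0; rewrite H, R; reflexivity).
  rewrite D3, D2, D1.
  assert (N : (k <= S (S n))%nat).
  { assert (Q : forall j, (j <= fact j)%nat).
    { intros j; induction j as [|j IH]; [lia|]. assert (F := lt_O_fact j); simpl; nia. }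
    specialize (Q k); lia. }
  destruct k as [|k]; [lia|]; replace (S k - 1)%nat with k by lia.
  change (fact (S k)) with (S k * fact k)%nat; rewrite mult_INR.
  assert (F := INR_fact_pos k); assert (G : 2 <= INR (S k)) by (apply (le_INR 2); lia).
  apply le_INR in N.
  rewrite Rinv_mult.
  assert (I : 0 < / INR (fact k)) by (apply Rinv_0_lt_compat, F).
  assert (J : / INR (S k) <= / 2) by (apply Rinv_le_contravar; lra).
  split; [nra|].
  assert (J2 : 1 <= INR (S (S n)) * / INR (S k)).
  { rewrite <- (Rinv_r (INR (S k))) by lra.
    apply Rmult_le_compat_r; [left; apply Rinv_0_lt_compat; lra|exact N]. }
  nra.
Qed.

Lemma beta0_polynomial_minoration : polynomial_minoration beta0.
Proof.
  exists 1, 1; repeat split; try lra.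
  intros n Hn; assert (P : 0 < INR n) by (apply lt_0_INR; lia).
  rewrite Rpower_Ropp, Rpower_1, Rmult_1_l by exact P.
  eapply Rle_trans; [|apply dec_le_beta0].
  apply Rinv_le_contravar; [apply INR_fact_pos|].
  destruct (rk_bounds n) as [_ [_ B]]; apply le_INR, B, Hn.
Qed.

Lemma beta0_not_essentially_decreasing : ~ essentially_decreasing beta0.
Proof.
  intros [C0 [C1 H]].
  destruct (INR_unbounded C0) as [k Hk].
  assert (K2 : (2 <= k)%nat).
  { destruct k as [|[|k]]; [simpl in Hk; lra|simpl in Hk; lra|lia]. }
  specialize (H (S (fact k)) (fact k) ltac:(lia)).
  unfold beta0, spike, dec in H.
  rewrite rk_fact, rk_S_fact, Nat.eqb_refl in H by lia.
  destruct (Nat.eqb_spec (fact k) (S (fact k))); [lia|].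
  destruct k as [|k]; [lia|]; replace (S k - 1)%nat with k in H by lia.
  change (fact (S k)) with (S k * fact k)%nat in H; rewrite mult_INR, Rinv_mult in H.
  assert (I : 0 < / INR (fact k)) by (apply Rinv_0_lt_compat, INR_fact_pos).
  assert (P : 0 < INR (S k)) by lra.
  assert (J : C0 * / INR (S k) < 1).
  { apply Rmult_lt_reg_r with (INR (S k)); [exact P|].
    rewrite Rmult_assoc, Rinv_l; lra. }
  nra.
Qed.

(** * Boundedness of the composition operator *)

Lemma comp_spike_bound c phi a n : ps_on 1 c phi ->
  (forall z, Cmod z < 1 -> Cmod (phi z) <= 1) -> c O = RtoC 0 ->
  Cmod (compc c a (S (S n))) ^ 2 <=
    2 * (rsum (fun k => Cmod (a k) ^ 2) (S n) + Cmod (a (S (S n))) ^ 2) +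
    2 * (Cmod (powc c (S n) (S (S n))) ^ 2 * Cmod (a (S n)) ^ 2).
Proof.
  intros H B C0.
  (* Removing the coefficient at the dip lets Littlewood's inequality handle all the others at once;
     the removed one is restored through its single matrix entry. *)
  pose (a' := fun k => if Nat.eqb k (S n) then RtoC 0 else a k).
  assert (Ea : forall k, k <> S n -> a' k = a k).
  { intros k Hk; unfold a'; destruct (Nat.eqb_spec k (S n)); [contradiction|reflexivity]. }
  assert (En : a' (S n) = RtoC 0) by (unfold a'; rewrite Nat.eqb_refl; reflexivity).
  assert (E : compc c a (S (S n)) = (compc c a' (S (S n)) + a (S n) * powc c (S n) (S (S n)))%C).
  { unfold compc; change (csum ?f (S (S (S n)))) with (csum f (S n) + f (S n) + f (S (S n)))%C.
    cbv beta.
    rewrite (csum_ext (fun m => a' m * powc c m (S (S n)))%C (fun m => a m * powc c m (S (S n)))%C)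
      by (intros k Hk; rewrite Ea by lia; reflexivity).
    rewrite En, (Ea (S (S n))) by lia; ring. }
  assert (L := comp_contractive c phi H B C0 (S (S (S n))) a').
  assert (T := rsum_term_le (fun k => Cmod (compc c a' k) ^ 2) (S (S n)) (S (S (S n))) ltac:(lia)
    (fun k => pow2_ge_0 _)); cbv beta in T.
  assert (R : rsum (fun k => Cmod (a' k) ^ 2) (S (S (S n))) =
    rsum (fun k => Cmod (a k) ^ 2) (S n) + Cmod (a (S (S n))) ^ 2).
  { change (rsum ?f (S (S (S n)))) with (rsum f (S n) + f (S n) + f (S (S n))); cbv beta.
    rewrite (rsum_ext (fun k => Cmod (a' k) ^ 2) (fun k => Cmod (a k) ^ 2))
      by (intros k Hk; rewrite Ea by lia; reflexivity).
    rewrite En, Cmod_0, (Ea (S (S n))) by lia; ring. }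
  rewrite R in L.
  set (x := compc c a' (S (S n))) in *; set (y := (a (S n) * powc c (S n) (S (S n)))%C) in *.
  assert (Y : Cmod (powc c (S n) (S (S n))) ^ 2 * Cmod (a (S n)) ^ 2 = Cmod y ^ 2)
    by (unfold y; rewrite Cmod_mult; ring).
  rewrite Y, E.
  assert (Tr := Cmod_triangle x y); assert (G := Cmod_ge_0 (x + y)%C).
  assert (Gx := Cmod_ge_0 x); assert (Gy := Cmod_ge_0 y).
  assert (Q : Cmod (x + y)%C ^ 2 <= 2 * Cmod x ^ 2 + 2 * Cmod y ^ 2).
  { apply Rle_trans with ((Cmod x + Cmod y) ^ 2); [apply pow_incr; lra|].
    assert (0 <= (Cmod x - Cmod y) ^ 2) by apply pow2_ge_0. nra. }
  lra.
Qed.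

Lemma beta0_bounded_composition c phi : ps_on 1 c phi -> (forall z, in_disk z -> in_disk (phi z)) ->
  c O = RtoC 0 -> bounded_composition beta0 phi.
Proof.
  intros H D C0; unfold in_disk in D.
  assert (B : forall z, Cmod z < 1 -> Cmod (phi z) <= 1) by (intros z Hz; left; apply D, Hz).
  destruct (subdiag_decay c phi H B C0) as [K [K0 HK]].
  exists (7 + 2 * K); intros a [A1 A2].
  assert (W : forall f n, 0 <= wterm beta0 f n).
  { intros f n; apply Rmult_le_pos; [apply pow2_ge_0|left; apply beta0_pos]. }
  assert (WE : forall f N, rsum (wterm beta0 f) N = rsum (fun n => beta0 n * Cmod (f n) ^ 2) N).
  { intros f N; apply rsum_ext; intros; unfold wterm; ring. }
  destruct (series_of_bounded (wterm beta0 (compc c a)) ((7 + 2 * K) * H2norm2 beta0 a)) as [S1 S2].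
  - apply W.
  - intros N; rewrite WE.
    apply (weighted_bound beta0 dec (fun n => Cmod (a n) ^ 2) (fun n => Cmod (compc c a n) ^ 2) spike).
    + apply dec_decr.
    + apply dec_le_beta0.
    + intros n Sn; unfold beta0; rewrite Sn; reflexivity.
    + reflexivity.
    + reflexivity.
    + intros; apply pow2_ge_0.
    + intros; apply pow2_ge_0.
    + exact K0.
    + intros n Sn; apply spike_SS, Sn.
    + intros n; apply (comp_contractive c phi H B C0).
    + intros n Sn; destruct (spike_SS n Sn) as [_ Q].
      assert (P := comp_spike_bound c phi a n H B C0).
      specialize (HK (S n) ltac:(lia)).
      assert (Bp := beta0_pos (S (S n))).
      apply Rmult_le_compat_l with (r := beta0 (S (S n))) in P; [|lra].
      eapply Rle_trans; [exact P|].
      set (x := Cmod (a (S n)) ^ 2); set (y := Cmod (powc c (S n) (S (S n))) ^ 2) in *.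
      assert (X0 : 0 <= x) by apply pow2_ge_0. assert (Y0 : 0 <= y) by apply pow2_ge_0.
      assert (T : beta0 (S (S n)) * (y * x) <= K * (beta0 (S n) * x)); [|lra].
      (* The ratio of spike to dip, bounded by the index, is paired with the squared matrix entry
         [y], and their product is at most [K]. *)
      apply Rle_trans with (INR (S (S n)) * dec (S n) * (y * x)).
      { apply Rmult_le_compat_r; [apply Rmult_le_pos; auto|exact Q]. }
      replace (INR (S (S n)) * dec (S n) * (y * x)) with ((INR (S (S n)) * y) * (dec (S n) * x)) by ring.
      apply Rmult_le_compat; auto.
      * apply Rmult_le_pos; [apply pos_INR|auto].
      * apply Rmult_le_pos; [left; apply dec_pos|auto].
      * apply Rmult_le_compat_r; [auto|apply dec_le_beta0].
    + intros M; rewrite <- WE; apply rsum_le_Series; auto.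
  - assert (CVA : forall z, Cmod z < 1 -> exists l, cv_sum (fun n => a n * z ^ n)%C l).
    { intros z Hz; destruct (A2 z Hz) as [l Hl]; exists l.
      apply is_series_cv_sum in Hl; revert Hl; apply cv_sum_ext; intros n.
      rewrite cpow_Cpow; reflexivity. }
    assert (V : forall z, Cmod z < 1 -> exists w, has_value (compc c a) z w /\ has_value a (phi z) w).
    { intros z Hz; destruct (CVA (phi z) (D z Hz)) as [w Hw]; exists w; unfold has_value.
      split; apply is_series_cv_sum.
      - apply (cv_sum_ext (fun n => compc c a n * z ^ n)%C);
          [intros k; f_equal; symmetry; apply cpow_Cpow|].
        apply (comp_value c phi); auto.
      - revert Hw; apply cv_sum_ext; intros k; f_equal; symmetry; apply cpow_Cpow. }
    exists (compc c a); split; [split; [exact S1|]|split; [exact V|exact S2]].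
    intros z Hz; destruct (V z Hz) as [w [Hw _]]; exists w; exact Hw.
Qed.

Theorem mainTheorem6 :
  exists beta : nat -> R,
    (forall n, 0 < beta n) /\
    (exists B, forall n, beta n <= B) /\
    polynomial_minoration beta /\
    ~ essentially_decreasing beta /\
    (forall phi : CC -> CC, symbol phi -> phi (RtoC 0) = RtoC 0 ->
       bounded_composition beta phi).
Proof.
  exists beta0; split; [exact beta0_pos|].
  split; [exists 1; exact beta0_le_1|].
  split; [exact beta0_polynomial_minoration|].
  split; [exact beta0_not_essentially_decreasing|].
  intros phi [HA [HD _]] H0.
  destruct (taylor_on_disk phi HA) as [c Hc]; [intros z Hz; left; apply HD, Hz|].
  apply (beta0_bounded_composition c phi Hc HD).
  assert (V := Hc (RtoC 0) ltac:(rewrite Cmod_0; lra)); rewrite H0 in V.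
  apply (cv_sum_unique (fun n => c n * RtoC 0 ^ n)%C); [|exact V].
  intros eps He; exists 1%nat; intros [|n] Hn; [lia|].
  rewrite csum_shift, csum_zero by (intros; rewrite Cpow_S; ring).
  replace (c O * RtoC 0 ^ 0 + 0 - c O)%C with (RtoC 0) by (simpl; ring).
  rewrite Cmod_0; exact He.
Qed.
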